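(* Let $(B,g_B)$ and $(F_j,g_{F_j})$, $1\le j\le l$, be radical-stationary semi-Riemannian manifolds and let $f_j\in C^\infty(B)$, $1\le j\le l$, be such that $df_j\in\mathcal A^\bullet(B)$. Then the multiply warped product manifold $B\times F_1\times\cdots\times F_l$ with warping functions $f_1,\dots,f_l$ is a radical-stationary semi-Riemannian manifold.
   Context: A singular semi-Riemannian manifold $(M,g)$ is a smooth manifold with a smooth symmetric $(0,2)$-tensor field $g=\langle\cdot,\cdot\rangle$, possibly degenerate and of varying signature. Its Koszul form is $\mathcal K(X,Y,Z)=\tfrac12\{X\langle Y,Z\rangle+Y\langle Z,X\rangle-Z\langle X,Y\rangle-\langle X,[Y,Z]\rangle+\langle Y,[Z,X]\rangle+\langle Z,[X,Y]\rangle\}$. $\mathcal A^\bullet(M)$ is the set of smooth 1-forms $\omega$ such that for each $p\in M$ there is $u\in T_pM$ with $\omega_p=\langle u,\cdot\rangle$. $(M,g)$ is radical-stationary if $\mathcal K(X,Y,\cdot)\in\mathcal A^\bullet(M)$ for all $X,Y\in\Gamma(TM)$. The multiply warped product is $B\times F_1\times\cdots\times F_l$ with the metric $\pi_B^*(g_B)+\sum_{j=1}^l(f_j\circ\pi_B)^2\pi_{F_j}^*(g_{F_j})$, where $\pi_B$, $\pi_{F_j}$ are the projections; the $f_j$ may have zeros. *)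

(* Defs.v *)
From HB Require Import structures.
From mathcomp Require Import all_boot all_order all_algebra.
From mathcomp Require Import all_classical all_reals all_analysis.

Set Implicit Arguments.
Unset Strict Implicit.
Unset Printing Implicit Defensive.

Import Order.TTheory GRing.Theory Num.Theory.
Import numFieldNormedType.Exports.

Local Open Scope classical_set_scope.
Local Open Scope ring_scope.

(* C^k maps on an open set U of R^n.  Since R^n is finite dimensional, the
   derivative x |-> 'd f x is C^k iff all the maps x |-> 'd f x v are. *)
Fixpoint of_class {R : realType} {n : nat} {W : normedModType R} (k : nat)
    (U : set 'rV[R]_n) (f : 'rV[R]_n -> W) : Prop :=
  if k is k'.+1 then
    (forall x, U x -> differentiable f x) /\
    (forall v, of_class k' U ('D_v f))
  else forall x, U x -> {for x, continuous f}.

Definition smooth_on {R : realType} {n : nat} {W : normedModType R}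
    (U : set 'rV[R]_n) (f : 'rV[R]_n -> W) : Prop :=
  forall k, of_class k U f.

(* A space with an atlas, not necessarily maximal, of candidate charts; the
   axioms are in [is_manifold].  The values of [coords c] outside [domain c]
   and those of [param c] outside [codomain c] are irrelevant. *)
Record atlas_space (R : realType) := AtlasSpace {
  points :> topologicalType;
  dim : nat;
  chart : Type;
  domain : chart -> set points;
  coords : chart -> points -> 'rV[R]_dim;
  param : chart -> 'rV[R]_dim -> points;
  chart_at : points -> chart
}.

Section Manifold.
Context {R : realType}.
Implicit Types M N : atlas_space R.

Definition codomain M (c : chart M) : set 'rV[R]_(dim M) :=
  coords c @` domain c.

Definition is_chart M (c : chart M) : Prop :=
  [/\ open (domain c),
      open (codomain c),
      (forall p, domain c p -> param c (coords c p) = p),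
      (forall p, domain c p -> {for p, continuous (coords c)}) &
      (forall x, codomain c x -> {for x, continuous (param c)})].

Definition transition M (c d : chart M) : 'rV[R]_(dim M) -> 'rV[R]_(dim M) :=
  coords d \o param c.

Definition is_manifold M : Prop :=
  [/\ hausdorff_space M,
      @second_countable M,
      (forall c : chart M, is_chart c),
      (forall p : M, domain (chart_at p) p) &
      (forall c d : chart M,
         smooth_on (coords c @` (domain c `&` domain d)) (transition c d))].

Definition base_coords M (p : M) : 'rV[R]_(dim M) := coords (chart_at p) p.

Definition smooth_fun M (f : M -> R) : Prop :=
  forall c : chart M, smooth_on (codomain c) (f \o param c).

(* A tangent vector at p is a class of pairs (chart around p, vector of R^n)
   modulo the derivatives of the transition maps.  Each class is represented by
   its unique member whose chart is [chart_at p], so that T_p M is R^n.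
   Vectors are rows: 'J f x acts on the right. *)
Definition tangent M (p : M) : normedModType R := 'rV[R]_(dim M).

Definition vector_field M : Type := forall p : M, tangent p.

Definition vf_coords M (X : vector_field M) (c : chart M)
    (x : 'rV[R]_(dim M)) : 'rV[R]_(dim M) :=
  let p := param c x in
  X p *m 'J (transition (chart_at p) c) (base_coords p).

Definition smooth_vf M (X : vector_field M) : Prop :=
  forall c : chart M, smooth_on (codomain c) (vf_coords X c).

Definition one_form M : Type := forall p : M, {linear tangent p -> R}.

(* Smoothness of a 1-form through its action on smooth vector fields. *)
Definition smooth_form M (w : one_form M) : Prop :=
  forall Z : vector_field M, smooth_vf Z -> smooth_fun (fun p => w p (Z p)).

Definition differential M (f : M -> R) : one_form M :=
  fun p => 'd (f \o param (chart_at p)) (base_coords p).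

Definition act M (X : vector_field M) (f : M -> R) : M -> R :=
  fun p => differential f p (X p).

Definition bracket M (X Y : vector_field M) : vector_field M :=
  fun p => 'D_(X p) (vf_coords Y (chart_at p)) (base_coords p)
         - 'D_(Y p) (vf_coords X (chart_at p)) (base_coords p).

Definition tangent_map M N (h : M -> N) (p : M) : 'M[R]_(dim M, dim N) :=
  'J (coords (chart_at (h p)) \o h \o param (chart_at p)) (base_coords p).

(* (0,2)-tensor fields, by their Gram matrices on the spaces T_p M. *)
Definition tensor2 M : Type := forall p : M, 'M[R]_(dim M).

Definition inner M (g : tensor2 M) (p : M) (u v : tangent p) : R :=
  (u *m g p *m v^T) 0 0.

Definition tensor2_coords M (g : tensor2 M) (c : chart M)
    (x : 'rV[R]_(dim M)) : 'M[R]_(dim M) :=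
  let p := param c x in
  let J := 'J (transition c (chart_at p)) x in
  J *m g p *m J^T.

Definition smooth_tensor2 M (g : tensor2 M) : Prop :=
  forall c : chart M, smooth_on (codomain c) (tensor2_coords g c).

Definition pullback M N (h : M -> N) (g : tensor2 N) : tensor2 M :=
  fun p => tangent_map h p *m g (h p) *m (tangent_map h p)^T.

(* No condition on the rank or the signature of g. *)
Definition singular_semi_riemannian M (g : tensor2 M) : Prop :=
  [/\ is_manifold M, (forall p, (g p)^T = g p) & smooth_tensor2 g].

Definition koszul M (g : tensor2 M) (X Y Z : vector_field M) : M -> R :=
  let ip (U V : vector_field M) : M -> R := fun p => inner g (U p) (V p) in
  fun p => 2^-1 * (act X (ip Y Z) p + act Y (ip Z X) p - act Z (ip X Y) p
                   - ip X (bracket Y Z) p + ip Y (bracket Z X) p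
                   + ip Z (bracket X Y) p).

Definition A_bullet M (g : tensor2 M) (w : one_form M) : Prop :=
  smooth_form w /\
  forall p : M, exists u : tangent p, forall v : tangent p, w p v = inner g u v.

(* The second clause says that the 1-form K(X, Y, .) is in A_bullet g. *)
Definition radical_stationary M (g : tensor2 M) : Prop :=
  singular_semi_riemannian g /\
  forall X Y : vector_field M, smooth_vf X -> smooth_vf Y ->
    exists2 w : one_form M, A_bullet g w &
      forall Z : vector_field M, smooth_vf Z ->
        forall p, koszul g X Y Z p = w p (Z p).

Section WarpedProduct.
Context {l : nat} (B : atlas_space R) (F : 'I_l -> atlas_space R).

Definition prod_points : topologicalType :=
  (B * prod_topology (fun j => points (F j)))%type.

Definition prod_dim : nat := (dim B + \sum_(j < l) dim (F j))%N.

Definition prod_chart : Type := (chart B * (forall j, chart (F j)))%type.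

Definition prod_manifold : atlas_space R := {|
  points := prod_points;
  dim := prod_dim;
  chart := prod_chart;
  domain := fun c : prod_chart => [set p : prod_points |
    domain c.1 p.1 /\ forall j, domain (c.2 j) (p.2 j)];
  coords := fun (c : prod_chart) (p : prod_points) =>
    row_mx (coords c.1 p.1) (\mxrow_(j < l) coords (c.2 j) (p.2 j));
  param := fun (c : prod_chart) (x : 'rV[R]_prod_dim) =>
    (param c.1 (lsubmx x), fun j => param (c.2 j) (submxrow (rsubmx x) j));
  chart_at := fun p : prod_points =>
    (chart_at p.1, fun j => chart_at (p.2 j))
|}.

Definition proj_base (p : prod_manifold) : B := p.1.

Definition proj_fiber (j : 'I_l) (p : prod_manifold) : F j := p.2 j.

Definition warped_metric (gB : tensor2 B) (gF : forall j, tensor2 (F j))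
    (f : 'I_l -> B -> R) : tensor2 prod_manifold :=
  fun p => pullback proj_base gB p
    + \sum_(j < l) (f j (proj_base p)) ^+ 2 *: pullback (proj_fiber j) (gF j) p.

End WarpedProduct.
End Manifold.

(* Main.v *)
(* A vector field [X] on the product restricts to the slice through a point [p]
   parallel to a factor, and its component along that factor is then a smooth
   vector field on the factor.  Hence radical-stationarity of the factors applies
   at each point of the product without extending tangent vectors.

   In a chart, K(X, Y, Z) = <D_X Y, Z> + Gamma(X, Y, Z) with Gamma the
   Christoffel symbols of the first kind, and for the warped metric
     Gamma = Gamma_B + sum_j f_j^2 Gamma_j
             + sum_j f_j (df_j(X) <Y, Z>_j + df_j(Y) <Z, X>_j - df_j(Z) <X, Y>_j).
   If u_B, u_j and grad f_j represent Gamma_B(X, Y, .), Gamma_j(X, Y, .) and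
   df_j, then Gamma(X, Y, .) is represented by the vector whose components are
   u_B - sum_j f_j <X, Y>_j grad f_j on B and
   u_j + f_j^-1 (df_j(X) Y_j + df_j(Y) X_j) on F_j.

   Smoothness of K(X, Y, Z) follows from the independence of the bracket from the
   chart, that is, from the symmetry of the second derivatives of the transition
   maps. *)

From HB Require Import structures.
Require Import Defs.
From mathcomp Require Import all_boot all_order all_algebra.
From mathcomp Require Import ring.
From mathcomp Require Import all_classical all_reals all_analysis.

Import Defs.

Set Implicit Arguments.
Unset Strict Implicit.
Unset Printing Implicit Defensive.

Import Order.TTheory GRing.Theory Num.Theory.
Import numFieldNormedType.Exports.

Local Open Scope classical_set_scope.
Local Open Scope ring_scope.

(** * Maps of class C^k *)

(** The summand <D_X Y, Z> is represented by D_X Y itself, so at a given point K(X, Y, .) is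
    represented by a vector exactly when Gamma(X, Y, .) is. This is used downwards on the factors
    ([christoffel_dual]) and upwards on the product ([koszul_warped_dual]). Neither summand is
    tensorial, but both are only taken at [p] in [chart_at p], and the [chart_at] of the product is
    made of those of the factors, so the splittings are compatible. The representing vector has its
    shape for the following reason. The term - f_j df_j(Z) <X, Y>_j sees Z only through the base; it
    becomes an inner product with Z because df_j lies in A(B). In the two other cross terms Z is
    paired on F_j with a single factor f_j, while the warped metric carries f_j^2: hence the f_j^-1.
    Representing vectors are chosen separately at every point, with no regularity. The 1-form that
    they define agrees with K(X, Y, .) on smooth fields, and its smoothness is read off from K. *)

Lemma near_eq_differentiable (R : numFieldType) (V W : normedModType R)
    (f g : V -> W) (x : V) :
  {near x, f =1 g} -> differentiable f x -> differentiable g x.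
Proof.
move=> fg df.
have fgx : f x = g x by exact: nbhs_singleton fg.
(* The first-order expansion of [f] at [x] involves only values near [x], so it is also an expansion
   of [g]; uniqueness of the differential then identifies ['d g x] with ['d f x]. *)
have gE : g \o shift x = cst (g x) + 'd f x +o_ 0 id.
  apply/eqaddoP => e e0.
  have /eqaddoP /(_ e e0) fE := diff_locally df.
  have fg0 : \forall y \near 0, f (y + x) = g (y + x).
    have c : (y + x) @[y --> (0 : V)] --> x.
      by rewrite -[X in _ --> X]add0r; apply: cvgD; [exact: cvg_id | exact: cvg_cst].
    exact: (c _ fg).
  near=> y.
  have : `|(f \o shift x - (cst (f x) + 'd f x)) y| <= e * `|id y| by near: y.
  rewrite /= !fctE /=.
  have -> : f (y + x) = g (y + x) by near: y.
  by rewrite fgx.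
have dE : 'd g x = 'd f x :> (V -> W).
  by apply: diff_unique gE; exact: diff_continuous.
by apply/diff_locallyP; rewrite dE; split => //; exact: diff_continuous.
Unshelve. all: by end_near. Qed.

Section OfClass.
Context {R : realType}.

(** Openness of [U] turns equality on [U] into equality near each of its points, which is all that
    continuity and derivatives see. Identities between chart expressions hold only on codomains and
    overlaps, and are exploited through this lemma. *)
Lemma of_class_eq n (W : normedModType R) k (U : set 'rV[R]_n)
    (f g : 'rV[R]_n -> W) :
  open U -> {in U, f =1 g} -> of_class k U f -> of_class k U g.
Proof.
move=> oU.
have near_fg (h1 h2 : 'rV[R]_n -> W) x :
    {in U, h1 =1 h2} -> U x -> {near x, h1 =1 h2}.
  move=> h12 Ux; have : \forall y \near x, U y by exact: open_nbhs_nbhs.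
  by apply: filterS => y Uy; apply: h12; rewrite inE.
elim: k f g => [|k IH] f g fg /=.
  move=> cf x Ux; suff : g @ x --> g x by [].
  have fgx := near_fg _ _ _ fg Ux.
  by rewrite -fg ?inE//; exact: cvg_trans (near_eq_cvg fgx) (cf x Ux).
move=> [df Df]; split=> [x Ux|v].
  by apply: near_eq_differentiable (df _ Ux); exact: near_fg fg _.
apply: IH (Df v) => x; rewrite inE => Ux.
by apply: near_eq_derive; exact: near_fg.
Qed.

Lemma of_class_sub n (W : normedModType R) k (U V : set 'rV[R]_n)
    (f : 'rV[R]_n -> W) :
  V `<=` U -> of_class k U f -> of_class k V f.
Proof.
move=> VU; elim: k f => [|k IH] f /=; first by move=> cf x /VU; exact: cf.
by move=> [df Df]; split=> [x /VU|v]; [exact: df | exact/IH].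
Qed.

Lemma of_classW n (W : normedModType R) k (U : set 'rV[R]_n)
    (f : 'rV[R]_n -> W) :
  of_class k.+1 U f -> of_class k U f.
Proof.
elim: k f => [|k IH] f.
  by move=> [df _] x Ux; apply: differentiable_continuous; exact: df.
by move=> [df Df]; split=> // v; exact: IH.
Qed.

Lemma of_class_cst n (W : normedModType R) k (U : set 'rV[R]_n) (a : W) :
  of_class k U (cst a : 'rV[R]_n -> W).
Proof.
elim: k a => [|k IH] a /=; first by move=> x _; exact: cst_continuous.
split=> [x _|v]; first exact: differentiable_cst.
rewrite (_ : 'D_v _ = cst 0)//.
by apply/funext => x; rewrite derive_cst.
Qed.

Lemma of_classD n (W : normedModType R) k (U : set 'rV[R]_n)
    (f g : 'rV[R]_n -> W) :
  open U -> of_class k U f -> of_class k U g ->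
  of_class k U (fun x => f x + g x).
Proof.
move=> oU; elim: k f g => [|k IH] f g /=.
  by move=> cf cg x Ux; exact: (cvgD (cf x Ux) (cg x Ux)).
move=> [df Df] [dg Dg]; split=> [x Ux|v].
  by apply: differentiableD; [exact: df | exact: dg].
apply: of_class_eq (IH _ _ (Df v) (Dg v)) => // x; rewrite inE => Ux.
by rewrite deriveD//; apply: diff_derivable; [exact: df | exact: dg].
Qed.

Lemma of_class_sum n (W : normedModType R) k (U : set 'rV[R]_n) (I : Type)
    (r : seq I) (P : pred I) (F : I -> 'rV[R]_n -> W) :
  open U -> (forall i, P i -> of_class k U (F i)) ->
  of_class k U (fun x => \sum_(i <- r | P i) F i x).
Proof.
move=> oU HF; elim: r => [|i r IH].
  apply: of_class_eq (of_class_cst k U 0) => // x _.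
  by rewrite big_nil.
have [Pi|nPi] := boolP (P i).
  apply: of_class_eq (of_classD oU (HF _ Pi) IH) => // x _.
  by rewrite big_cons Pi.
by apply: of_class_eq IH => // x _; rewrite big_cons (negPf nPi).
Qed.

(** In the product rule each derivative, of class k, multiplies a factor of class k+1, which
    [of_classW] weakens so that the induction hypothesis applies. *)
Lemma of_classM n k (U : set 'rV[R]_n) (f g : 'rV[R]_n -> R) :
  open U -> of_class k U f -> of_class k U g ->
  of_class k U (fun x => f x * g x).
Proof.
move=> oU; elim: k f g => [|k IH] f g.
  by move=> cf cg x Ux; exact: (cvgM (cf x Ux) (cg x Ux)).
move=> Cf Cg; have [df Df] := Cf; have [dg Dg] := Cg; split=> [x Ux|v].
  by apply: differentiableM; [exact: df | exact: dg].
have := of_classD oU (IH _ _ (of_classW Cf) (Dg v)) (IH _ _ (of_classW Cg) (Df v)).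
apply: of_class_eq => // x; rewrite inE => Ux.
by rewrite deriveM//; apply: diff_derivable; [exact: df | exact: dg].
Qed.

Lemma differentiable_mxP n p q (f : 'rV[R]_n -> 'M[R]_(p, q)) x :
  (forall i j, differentiable (fun y => f y i j) x) -> differentiable f x.
Proof.
move=> df.
have -> : f = \sum_(i < p) \sum_(j < q) (fun y => f y i j *: delta_mx i j).
  apply/funext => y; rewrite [LHS]matrix_sum_delta fct_sumE.
  by apply: eq_bigr => i _; rewrite fct_sumE.
apply: differentiable_sum => i; apply: differentiable_sum => j.
exact: differentiableZl.
Qed.

Lemma differentiable_entry n p q (f : 'rV[R]_n -> 'M[R]_(p, q)) x i j :
  differentiable f x -> differentiable (fun y => f y i j) x.
Proof.
move=> df; exact: (@differentiable_comp _ _ _ _ f (fun N => N i j) x df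
  (differentiable_coord _ _ _)).
Qed.

Lemma derive_entry n p q (f : 'rV[R]_n -> 'M[R]_(p, q)) x v i j :
  derivable f x v -> 'D_v f x i j = 'D_v (fun y => f y i j) x.
Proof. by move=> df; rewrite derive_mx// mxE. Qed.

Lemma of_class_entry n p q k (U : set 'rV[R]_n) (f : 'rV[R]_n -> 'M[R]_(p, q)) i j :
  open U -> of_class k U f -> of_class k U (fun x => f x i j).
Proof.
move=> oU; elim: k f => [|k IH] f /=.
  move=> cf x Ux; exact: (@continuous_comp _ _ _ f (fun N => N i j) x (cf x Ux)
    (@coord_continuous _ _ _ i j (f x))).
move=> [df Df]; split=> [x Ux|v]; first by apply: differentiable_entry; exact: df.
apply: of_class_eq (IH _ (Df v)) => // x; rewrite inE => Ux.
by rewrite derive_entry//; apply: diff_derivable; exact: df.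
Qed.

(** A neighbourhood of a matrix contains a box of neighbourhoods [P i j] of its entries; there are
    finitely many of them, so they are entered simultaneously near [x]. *)
Lemma continuous_mxP (T : topologicalType) p q (f : T -> 'M[R]_(p, q)) (x : T) :
  (forall i j, {for x, continuous (fun y => f y i j)}) -> {for x, continuous f}.
Proof.
move=> cf A [P /= PN PA].
have {}cf i j : \forall y \near x, P i j (f y i j) by exact: (cf i j _ (PN i j)).
near=> y; apply: PA => i j.
move: i j; near: y.
apply: filter_forall => i; apply: filter_forall => j; exact: cf.
Unshelve. all: by end_near. Qed.

(** Reduces matrix-valued maps to real-valued ones, for which the product and chain rules are proved
    by induction on the class. *)
Lemma of_class_mx n p q k (U : set 'rV[R]_n) (f : 'rV[R]_n -> 'M[R]_(p, q)) :
  open U -> (forall i j, of_class k U (fun x => f x i j)) -> of_class k U f.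
Proof.
move=> oU; elim: k f => [|k IH] f Cf.
  by move=> x Ux; apply: continuous_mxP => i j; exact: Cf.
have df x : U x -> differentiable f x.
  by move=> Ux; apply: differentiable_mxP => i j; exact: (Cf i j).1.
split=> // v; apply: IH => i j.
apply: of_class_eq ((Cf i j).2 v) => // x; rewrite inE => Ux.
by rewrite derive_entry//; apply: diff_derivable; exact: df.
Qed.

Lemma diff_delta n (W : normedModType R) (f : 'rV[R]_n -> W) x v :
  'd f x v = \sum_(i < n) v 0 i *: 'd f x (delta_mx 0 i).
Proof.
rewrite [in LHS](row_sum_delta v) linear_sum.
by apply: eq_bigr => i _; rewrite linearZ.
Qed.

Lemma of_class_comp_real n m k (U : set 'rV[R]_n) (V : set 'rV[R]_m)
    (f : 'rV[R]_m -> R) (h : 'rV[R]_n -> 'rV[R]_m) :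
  open U -> (forall x, U x -> V (h x)) ->
  of_class k U h -> of_class k V f -> of_class k U (f \o h).
Proof.
move=> oU UV; elim: k f h UV => [|k IH] f h UV.
  move=> ch cf x Ux; apply: continuous_comp; first exact: ch.
  by apply: cf; exact: UV.
move=> Ch Cf; have [dh Dh] := Ch; have [df Df] := Cf; split=> [x Ux|v].
  by apply: differentiable_comp; [exact: dh | apply: df; exact: UV].
(* The chain rule with ['D_v h x] expanded in the standard basis: that direction moves with [x],
   while [of_class] controls derivatives of [f] in fixed directions only. *)
have HS : of_class k U
    (fun x => \sum_(i < m) 'D_v h x 0 i * ('D_(delta_mx 0 i) f \o h) x).
  apply: of_class_sum => // i _; apply: of_classM => //.
    exact: (of_class_entry 0 i oU (Dh v)).
  exact: (IH _ _ UV (of_classW Ch) (Df _)).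
apply: of_class_eq HS => // x; rewrite inE => Ux.
have [dhx dfx] := (dh _ Ux, df _ (UV _ Ux)).
rewrite [RHS]deriveE; last exact: differentiable_comp.
rewrite diff_comp//= diff_delta.
by apply: eq_bigr => i _; rewrite !deriveE.
Qed.

Lemma of_class_comp n m p q k (U : set 'rV[R]_n) (V : set 'rV[R]_m)
    (f : 'rV[R]_m -> 'M[R]_(p, q)) (h : 'rV[R]_n -> 'rV[R]_m) :
  open U -> open V -> (forall x, U x -> V (h x)) ->
  of_class k U h -> of_class k V f -> of_class k U (f \o h).
Proof.
move=> oU oV UV Ch Cf; apply: of_class_mx => // i j.
exact: (of_class_comp_real oU UV Ch (of_class_entry i j oV Cf)).
Qed.

Lemma of_class_mulmx n p q r k (U : set 'rV[R]_n)
    (f : 'rV[R]_n -> 'M[R]_(p, q)) (g : 'rV[R]_n -> 'M[R]_(q, r)) :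
  open U -> of_class k U f -> of_class k U g ->
  of_class k U (fun x => f x *m g x).
Proof.
move=> oU Cf Cg; apply: of_class_mx => // i j.
have H : of_class k U (fun x => \sum_l f x i l * g x l j).
  apply: of_class_sum => // l _.
  exact: (of_classM oU (of_class_entry i l oU Cf) (of_class_entry l j oU Cg)).
by apply: of_class_eq H => // x _; rewrite mxE.
Qed.

Lemma of_class_trmx n p q k (U : set 'rV[R]_n) (f : 'rV[R]_n -> 'M[R]_(p, q)) :
  open U -> of_class k U f -> of_class k U (fun x => (f x)^T).
Proof.
move=> oU Cf; apply: of_class_mx => // i j.
by apply: of_class_eq (of_class_entry j i oU Cf) => // x _; rewrite mxE.
Qed.

Lemma of_classZ n p q k (U : set 'rV[R]_n) (a : 'rV[R]_n -> R)
    (f : 'rV[R]_n -> 'M[R]_(p, q)) :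
  open U -> of_class k U a -> of_class k U f ->
  of_class k U (fun x => a x *: f x).
Proof.
move=> oU Ca Cf; apply: of_class_mx => // i j.
apply: of_class_eq (of_classM oU Ca (of_class_entry i j oU Cf)) => // x _.
by rewrite mxE.
Qed.

Lemma of_class_id n k (U : set 'rV[R]_n) : of_class k U (fun x : 'rV[R]_n => x).
Proof.
case: k => [|k] /=; first by move=> x _ A.
split=> [x _|v]; first exact: ex_diff.
rewrite (_ : 'D_v _ = cst v); first exact: of_class_cst.
by apply/funext => x; rewrite derive_id.
Qed.

Lemma jacobian_entry n m (f : 'rV[R]_n -> 'rV[R]_m) x i j :
  differentiable f x -> 'J f x i j = 'D_(delta_mx 0 i) f x 0 j.
Proof. by move=> df; rewrite deriveEjacobian// -rowE [in RHS]mxE. Qed.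

Lemma of_class_jacobian n m k (U : set 'rV[R]_n) (f : 'rV[R]_n -> 'rV[R]_m) :
  open U -> of_class k.+1 U f -> of_class k U (jacobian f).
Proof.
move=> oU [df Df]; apply: of_class_mx => // i j.
apply: of_class_eq (of_class_entry 0 j oU (Df (delta_mx 0 i))) => // x.
by rewrite inE => Ux; rewrite jacobian_entry//; exact: df.
Qed.

(** Expanding the moving direction [X x] in the standard basis reduces to the fixed directions of
    [of_class]. One order is lost on [f], none on [X]. *)
Lemma of_class_derive_along n k (U : set 'rV[R]_n) (X : 'rV[R]_n -> 'rV[R]_n)
    (f : 'rV[R]_n -> R) :
  open U -> of_class k U X -> of_class k.+1 U f ->
  of_class k U (fun x => 'D_(X x) f x).
Proof.
move=> oU CX [df Df].
have H : of_class k U (fun x => \sum_i X x 0 i * 'D_(delta_mx 0 i) f x).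
  apply: of_class_sum => // i _.
  exact: (of_classM oU (of_class_entry 0 i oU CX) (Df _)).
apply: of_class_eq H => // x; rewrite inE => /df dfx.
rewrite deriveE// diff_delta.
by apply: eq_bigr => i _; rewrite deriveE.
Qed.

Lemma of_class_derive_along_mx n p q k (U : set 'rV[R]_n)
    (X : 'rV[R]_n -> 'rV[R]_n) (f : 'rV[R]_n -> 'M[R]_(p, q)) :
  open U -> of_class k U X -> of_class k.+1 U f ->
  of_class k U (fun x => 'D_(X x) f x).
Proof.
move=> oU CX Cf; apply: of_class_mx => // i j.
apply: of_class_eq (of_class_derive_along oU CX (of_class_entry i j oU Cf)) => // x.
rewrite inE => Ux; rewrite derive_entry//.
by apply: diff_derivable; exact: Cf.1.
Qed.

End OfClass.

(** * Differentiation rules and Schwarz's theorem *)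

Section DerivativeRules.
Context {R : realType}.

Lemma derivable_mulmx n p q r (f : 'rV[R]_n -> 'M[R]_(p, q))
    (g : 'rV[R]_n -> 'M[R]_(q, r)) x v :
  derivable f x v -> derivable g x v -> derivable (fun y => f y *m g y) x v.
Proof.
move=> /derivable_mxP df /derivable_mxP dg; apply/derivable_mxP => i j.
have -> : (fun y => (f y *m g y) i j) =
    \sum_(k < q) ((fun y => f y i k) * (fun y => g y k j)).
  by apply/funext => y; rewrite mxE fct_sumE.
by apply: derivable_sum => k; exact: derivableM.
Qed.

Lemma derive_mulmx n p q r (f : 'rV[R]_n -> 'M[R]_(p, q))
    (g : 'rV[R]_n -> 'M[R]_(q, r)) x v :
  derivable f x v -> derivable g x v ->
  'D_v (fun y => f y *m g y) x = 'D_v f x *m g x + f x *m 'D_v g x.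
Proof.
move=> df dg; apply/matrixP => i j.
rewrite derive_entry; last exact: derivable_mulmx.
have -> : (fun y => (f y *m g y) i j) =
    \sum_(k < q) ((fun y => f y i k) * (fun y => g y k j)).
  by apply/funext => y; rewrite mxE fct_sumE.
have [/derivable_mxP df' /derivable_mxP dg'] := (df, dg).
rewrite derive_sum; last by move=> k; exact: derivableM.
rewrite !mxE -big_split/=; apply: eq_bigr => k _.
by rewrite deriveM// -!derive_entry// addrC; congr (_ + _); exact: mulrC.
Qed.

Lemma derivable_trmx n p q (f : 'rV[R]_n -> 'M[R]_(p, q)) x v :
  derivable f x v -> derivable (fun y => (f y)^T) x v.
Proof.
move=> /derivable_mxP df; apply/derivable_mxP => i j.
have -> : (fun y => (f y)^T i j) = (fun y => f y j i).
  by apply/funext => y; rewrite mxE.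
exact: df.
Qed.

Lemma derive_trmx n p q (f : 'rV[R]_n -> 'M[R]_(p, q)) x v :
  derivable f x v -> 'D_v (fun y => (f y)^T) x = ('D_v f x)^T.
Proof.
move=> df; apply/matrixP => i j.
rewrite derive_entry; last exact: derivable_trmx.
rewrite mxE derive_entry//; congr ('D_v _ x).
by apply/funext => y; rewrite mxE.
Qed.

Lemma derivableZl n p q (a : 'rV[R]_n -> R) (f : 'rV[R]_n -> 'M[R]_(p, q)) x v :
  derivable a x v -> derivable f x v -> derivable (fun y => a y *: f y) x v.
Proof.
move=> da /derivable_mxP df; apply/derivable_mxP => i j.
have -> : (fun y => (a y *: f y) i j) = a * (fun y => f y i j).
  by apply/funext => y; rewrite mxE.
exact: (@derivableM _ _ a (fun y => f y i j) x v da (df i j)).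
Qed.

Lemma deriveZl n p q (a : 'rV[R]_n -> R) (f : 'rV[R]_n -> 'M[R]_(p, q)) x v :
  derivable a x v -> derivable f x v ->
  'D_v (fun y => a y *: f y) x = 'D_v a x *: f x + a x *: 'D_v f x.
Proof.
move=> da df; apply/matrixP => i j.
rewrite derive_entry; last exact: derivableZl.
have -> : (fun y => (a y *: f y) i j) = a * (fun y => f y i j).
  by apply/funext => y; rewrite mxE.
have /derivable_mxP df' := df.
rewrite (@deriveM _ _ a (fun y => f y i j) x v da (df' i j)) !mxE.
by rewrite -(derive_entry i j df) addrC [_ *: 'D_v a x]mulrC.
Qed.

Lemma derive_mulmxr n p q r (f : 'rV[R]_n -> 'M[R]_(p, q)) (A : 'M[R]_(q, r)) x v :
  derivable f x v -> 'D_v (fun y => f y *m A) x = 'D_v f x *m A.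
Proof.
move=> df; rewrite (@derive_mulmx _ _ _ _ f (cst A))//.
by rewrite derive_cst mulmx0 addr0.
Qed.

Lemma derive_mulmxl n p q r (A : 'M[R]_(p, q)) (f : 'rV[R]_n -> 'M[R]_(q, r)) x v :
  derivable f x v -> 'D_v (fun y => A *m f y) x = A *m 'D_v f x.
Proof.
move=> df; rewrite (@derive_mulmx _ _ _ _ (cst A) f)//.
by rewrite derive_cst mul0mx add0r.
Qed.

Lemma derive_comp_along n m (W : normedModType R) (f : 'rV[R]_m -> W)
    (h : 'rV[R]_n -> 'rV[R]_m) x v :
  differentiable h x -> differentiable f (h x) ->
  'D_v (f \o h) x = 'D_(v *m 'J h x) f (h x).
Proof.
move=> dh df; rewrite deriveE; last exact: differentiable_comp.
by rewrite diff_comp//= -deriveEjacobian// !deriveE.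
Qed.

Lemma jacobian_comp n m p (f : 'rV[R]_m -> 'rV[R]_p)
    (h : 'rV[R]_n -> 'rV[R]_m) x :
  differentiable h x -> differentiable f (h x) ->
  'J (f \o h) x = 'J h x *m 'J f (h x).
Proof.
move=> dh df; apply/row_matrixP => i; rewrite row_mul !rowE.
rewrite -deriveEjacobian; last exact: differentiable_comp.
by rewrite derive_comp_along// deriveEjacobian.
Qed.

(** The constant term makes the statement cover translations, needed for second differences;
    projections and the identity are the case [b = 0]. *)
Lemma jacobian_linear n m (A : 'M[R]_(n, m)) (b : 'rV[R]_m) x :
  differentiable (fun y => y *m A + b) x /\ 'J (fun y => y *m A + b) x = A.
Proof.
have d : differentiable (fun y : 'rV[R]_n => y *m A) x.
  have C : of_class 1 setT (fun y : 'rV[R]_n => y *m A).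
    apply: (@of_class_mulmx _ _ _ _ _ _ _ (fun y => y) (cst A)); first exact: openT.
      exact: of_class_id.
    exact: of_class_cst.
  exact: C.1.
have d' : differentiable (fun y : 'rV[R]_n => y *m A + b) x.
  exact: (@differentiableD _ _ _ (fun y : 'rV[R]_n => y *m A) (cst b) x d
    (differentiable_cst _ _)).
split => //; apply/row_matrixP => i; rewrite !rowE -deriveEjacobian//.
have did v : derivable (fun y : 'rV[R]_n => y) x v by exact: derivable_id.
rewrite (@deriveD _ _ _ (fun y : 'rV[R]_n => y *m A) (cst b)).
- by rewrite derive_cst addr0 derive_mulmxr// derive_id.
- exact: diff_derivable.
- exact: derivable_cst.
Qed.

End DerivativeRules.

Section LocalEquality.
Context {R : realType} {n : nat}.
Implicit Types (U : set 'rV[R]_n) (x : 'rV[R]_n).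

Lemma near_eq_open (W : normedModType R) U x (f g : 'rV[R]_n -> W) :
  open U -> U x -> (forall y, U y -> f y = g y) -> {near x, f =1 g}.
Proof.
move=> oU Ux fg; have : \forall y \near x, U y by exact: open_nbhs_nbhs.
exact: filterS.
Qed.

Lemma derive_eq_open (W : normedModType R) U x v (f g : 'rV[R]_n -> W) :
  open U -> U x -> (forall y, U y -> f y = g y) -> 'D_v f x = 'D_v g x.
Proof. by move=> oU Ux fg; apply: near_eq_derive; exact: near_eq_open fg. Qed.

Lemma jacobian_eq_open m U x (f g : 'rV[R]_n -> 'rV[R]_m) :
  open U -> U x -> (forall y, U y -> f y = g y) -> differentiable f x ->
  'J f x = 'J g x.
Proof.
move=> oU Ux fg df.
have dg := near_eq_differentiable (near_eq_open oU Ux fg) df.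
have key (v : 'rV_n) : v *m 'J f x = v *m 'J g x.
  have E : 'D_v f x = 'D_v g x by exact: derive_eq_open fg.
  have Ef : 'D_v f x = v *m 'J f x by exact: deriveEjacobian.
  have Eg : 'D_v g x = v *m 'J g x by exact: deriveEjacobian.
  exact: etrans (esym Ef) (etrans E Eg).
apply/row_matrixP => i.
exact: (etrans (rowE _ _) (etrans (key _) (esym (rowE _ _)))).
Qed.

End LocalEquality.

Section Schwarz.
Context {R : realType} {n : nat}.
Implicit Types (f : 'rV[R]_n -> R) (x u v : 'rV[R]_n).

(** Restriction to a line turns a directional derivative into an ordinary one, to which the
    one-variable mean value theorem applies. *)
Lemma derive_line f x u (t : R) :
  differentiable f (x + t *: u) ->
  is_derive t 1 (fun s : R => f (x + s *: u)) ('D_u f (x + t *: u)).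
Proof.
move=> df.
have dl : is_diff t (fun s : R => x + s *: u) (fun s : R => s *: u).
  have := @is_diffD _ _ _ (cst x) (fun s : R => s *: u) 0 (fun s : R => s *: u) t.
  rewrite add0r; apply; exact: is_diff_scalel.
have d := @differentiable_comp _ _ _ _ (fun s : R => x + s *: u) f t
  (@ex_diff _ _ _ _ _ _ _ dl) df.
apply: DeriveDef; first exact: (diff_derivable d).
rewrite deriveE// (@diff_comp _ _ _ _ (fun s : R => x + s *: u) f)//.
rewrite /= (@diff_val _ _ _ _ _ _ _ dl) scale1r deriveE//.
Qed.

Lemma MVT_line f x u (h : R) : 0 < h ->
  (forall t, 0 <= t <= h -> differentiable f (x + t *: u)) ->
  exists2 c, 0 <= c <= h & f (x + h *: u) - f x = 'D_u f (x + c *: u) * h.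
Proof.
move=> h0 df.
have [||c ch] := @MVT R (fun s : R => f (x + s *: u))
    (fun s => 'D_u f (x + s *: u)) 0 h h0.
- move=> t /[!in_itv]/= /andP[t0 th]; apply: derive_line.
  by apply: df; rewrite !ltW.
- apply: derivable_within_continuous => t /[!in_itv]/= th.
  by apply: (@ex_derive _ _ _ _ _ _ _ (derive_line _)); exact: df.
rewrite scale0r addr0 subr0 => E.
by exists c => //; move: ch; rewrite in_itv/= => /andP[? ?]; rewrite !ltW.
Qed.

(** The mean value theorem is applied twice: along [u] to the increment
    [G y = f (y + h *: v) - f y], then along [v] to ['D_u f]. *)
Lemma second_difference f x u v (h : R) (U : set 'rV[R]_n) : 0 < h ->
  open U -> of_class 2 U f ->
  (forall s t, 0 <= s <= h -> 0 <= t <= h -> U (x + s *: u + t *: v)) ->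
  exists s t, [/\ 0 <= s <= h, 0 <= t <= h &
    f (x + h *: u + h *: v) - f (x + h *: u) - (f (x + h *: v) - f x)
    = 'D_v ('D_u f) (x + s *: u + t *: v) * h * h].
Proof.
move=> h0 oU [df Df] HU.
have hh : 0 <= h <= h by rewrite lexx ltW.
have h00 : 0 <= (0 : R) <= h by rewrite lexx ltW.
pose G y := f (y + h *: v) - f y.
have dsh y : differentiable (fun y : 'rV[R]_n => y + h *: v) y.
  by apply: differentiableD => //; exact: differentiable_cst.
have Gd t : 0 <= t <= h -> differentiable f (x + t *: u) /\
    differentiable (fun y => f (y + h *: v)) (x + t *: u).
  move=> th; split; first by apply: df; have := HU t 0 th h00; rewrite scale0r addr0.
  apply: (@differentiable_comp _ _ _ _ (fun y => y + h *: v) f) => //.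
  by apply: df; exact: HU.
have [|s sh E1] := @MVT_line G x u h h0.
  by move=> t /Gd[d1 d2]; exact: differentiableB.
have [|t th E2] := @MVT_line ('D_u f) (x + s *: u) v h h0.
  by move=> t th; apply: (Df u).1; exact: HU.
exists s, t; split => //.
have [d1 d2] := Gd _ sh.
have E3 : 'D_u G (x + s *: u) =
    'D_u f (x + s *: u + h *: v) - 'D_u f (x + s *: u).
  rewrite /G (@deriveB _ _ _ (fun y => f (y + h *: v)) f _ _ (diff_derivable d2)
    (diff_derivable d1)).
  set z := x + s *: u; apply: (congr1 (fun r => r - 'D_u f z)).
  have dfz : differentiable f (z + h *: v) by apply: df; exact: HU.
  rewrite -[LHS]/('D_u (f \o (fun y => y + h *: v)) z).
  rewrite (derive_comp_along _ (dsh z) dfz).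
  have [_] := @jacobian_linear R n n 1%:M (h *: v) z.
  under eq_fun do rewrite mulmx1.
  by move=> ->; rewrite mulmx1.
have EG : f (x + h *: u + h *: v) - f (x + h *: u) - (f (x + h *: v) - f x) =
  G (x + h *: u) - G x by [].
by rewrite EG E1 E3 E2.
Qed.

(** The second difference is symmetric in [u] and [v], so a value of ['D_v ('D_u f)] near [x] equals
    a value of ['D_u ('D_v f)] at another point near [x]. Both second derivatives are continuous at
    [x], so their values there differ by at most any [e]. *)
Lemma derive_comm f x u v (U : set 'rV[R]_n) :
  open U -> of_class 2 U f -> U x -> 'D_u ('D_v f) x = 'D_v ('D_u f) x.
Proof.
move=> oU Cf Ux; apply/eqP; rewrite -subr_eq0 -normr_eq0; apply/eqP.
apply: le_anti; rewrite normr_ge0 andbT; apply/ler_addgt0Pr => e e0; rewrite add0r.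
have close (a b c : R) : `|a - c| < e / 2 -> `|b - c| < e / 2 -> `|a - b| <= e.
  move=> ac bc; rewrite -(subrKA c); apply: (le_trans (ler_normD _ _)).
  by rewrite (splitr e) lerD ?ltW// distrC.
have [df Df] := Cf.
have e20 : 0 < e / 2 by rewrite divr_gt0.
have n1 : \forall y \near x, `|'D_u ('D_v f) x - 'D_u ('D_v f) y| < e / 2.
  exact: ((cvgrPdist_lt _ _).1 ((Df v).2 u x Ux) _ e20).
have n2 : \forall y \near x, `|'D_v ('D_u f) x - 'D_v ('D_u f) y| < e / 2.
  exact: ((cvgrPdist_lt _ _).1 ((Df u).2 v x Ux) _ e20).
have n3 : \forall y \near x, U y by exact: open_nbhs_nbhs.
have /nbhs_ballP[r /= r0 Hr] : \forall y \near x, U y /\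
    (`|'D_u ('D_v f) x - 'D_u ('D_v f) y| < e / 2 /\
     `|'D_v ('D_u f) x - 'D_v ('D_u f) y| < e / 2).
  exact: filterI n3 (filterI n1 n2).
(* The step [h] makes the parallelogram spanned by [h *: u] and [h *: v] fit in the ball of radius
   [r]. The summand 1 keeps [K] positive when [u] and [v] vanish, and the division by 2 makes the
   bound strict. *)
pose K : R := 1 + `|u| + `|v|.
have K0 : 0 < K by rewrite /K -addrA ltr_pwDl// addr_ge0.
pose h := r / K / 2.
have h0 : 0 < h by rewrite /h !divr_gt0.
have hK : h * (`|u| + `|v|) < r.
  apply: (@le_lt_trans _ _ (h * K)).
    by rewrite ler_pM2l// /K -addrA lerDr.
  by rewrite /h mulrAC divfK ?gt_eqF// ltr_pdivrMr// ltr_pMr// ltr1n.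
have Hb s t : 0 <= s <= h -> 0 <= t <= h -> ball x r (x + s *: u + t *: v).
  move=> /andP[s0 sh] /andP[t0 th].
  rewrite -ball_normE/= -addrA opprD addrA subrr add0r normrN.
  apply: le_lt_trans hK; apply: (le_trans (ler_normD _ _)).
  by rewrite !normrZ !ger0_norm// mulrDr lerD// ler_wpM2r.
have [s [t [sh th E1]]] := second_difference (u := u) (v := v) h0 oU Cf
  (fun s t sh th => (Hr _ (Hb s t sh th)).1).
have Hb' s' t' : 0 <= s' <= h -> 0 <= t' <= h -> ball x r (x + s' *: v + t' *: u).
  by move=> s'h t'h; rewrite addrAC; exact: Hb.
have [s' [t' [sh' th' E2]]] := second_difference (u := v) (v := u) h0 oU Cf
  (fun s t sh th => (Hr _ (Hb' s t sh th)).1).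
have E : 'D_v ('D_u f) (x + s *: u + t *: v) =
         'D_u ('D_v f) (x + s' *: v + t' *: u).
  (* Here [a], [b], [c], [d] are the values of [f] at x + hu + hv, x + hu, x + hv and x. Exchanging
     [u] and [v] exchanges [b] and [c], which does not change the second difference. *)
  have cancel (a b c d p q : R) : a - b - (c - d) = p * h * h ->
      a - c - (b - d) = q * h * h -> p = q.
    have h0' : h != 0 by rewrite gt_eqF.
    move=> pE qE; apply: (mulIf h0'); apply: (mulIf h0').
    by rewrite -pE -qE; ring.
  move: E1 E2; set D1 := 'D_v _ _; set D2 := 'D_u _ _.
  rewrite [x + h *: v + _]addrAC; exact: cancel.
have [_ [_ B1]] := Hr _ (Hb _ _ sh th).
have [_ [B2 _]] := Hr _ (Hb' _ _ sh' th').
rewrite E in B1.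
exact: close B2 B1.
Qed.

Lemma derive_comm_mx p q (f : 'rV[R]_n -> 'M[R]_(p, q)) x u v (U : set 'rV[R]_n) :
  open U -> of_class 2 U f -> U x -> 'D_u ('D_v f) x = 'D_v ('D_u f) x.
Proof.
move=> oU Cf Ux; apply/matrixP => i j.
have H w w' : 'D_w ('D_w' f) x i j = 'D_w ('D_w' (fun y => f y i j)) x.
  rewrite derive_entry; last exact: (diff_derivable ((Cf.2 w').1 x Ux)).
  apply: near_eq_derive; near=> y.
  rewrite derive_entry//; apply: diff_derivable; apply: Cf.1.
  by near: y; exact: open_nbhs_nbhs.
have comm := derive_comm u v oU (of_class_entry i j oU Cf) Ux.
exact: (etrans (H u v) (etrans comm (esym (H v u)))).
Unshelve. all: by end_near. Qed.

End Schwarz.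

(** * Charts *)

Lemma mulmx_congruence (R : comPzRingType) n m (u v : 'rV[R]_n) (J : 'M[R]_(n, m))
    (G : 'M[R]_m) :
  u *m J *m G *m (v *m J)^T = u *m (J *m G *m J^T) *m v^T.
Proof. by rewrite trmx_mul !mulmxA. Qed.

Section Charts.
Context {R : realType} (M : atlas_space R) (hM : is_manifold M).
Implicit Types (c d e : chart M) (x : 'rV[R]_(dim M)) (p : M).

Definition overlap c d : set 'rV[R]_(dim M) := coords c @` (domain c `&` domain d).

Lemma paramK c p : domain c p -> param c (coords c p) = p.
Proof. by case: hM => _ _ /(_ c)[_ _ + _ _] _ _; exact. Qed.

Lemma overlapE c d x : overlap c d x <-> codomain c x /\ domain d (param c x).
Proof.
split=> [[p [cp dp] <-]|[[p cp <-]]]; rewrite paramK//.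
- by split=> //; exists p.
- by move=> dp; exists p.
Qed.

Lemma codomain_param c x : codomain c x -> domain c (param c x).
Proof. by case=> p cp <-; rewrite paramK. Qed.

Lemma coordsK c x : codomain c x -> coords c (param c x) = x.
Proof. by case=> p cp <-; rewrite paramK. Qed.

Lemma codomain_coords c p : domain c p -> codomain c (coords c p).
Proof. by exists p. Qed.

Lemma open_codomain c : open (codomain c).
Proof. by case: hM => _ _ /(_ c)[]. Qed.

Lemma chart_at_domain p : domain (chart_at p) p.
Proof. by case: hM. Qed.

Lemma base_coords_codomain p : codomain (chart_at p) (base_coords p).
Proof. by exists p => //; exact: chart_at_domain. Qed.

Lemma param_base_coords p : param (chart_at p) (base_coords p) = p.
Proof. exact/paramK/chart_at_domain. Qed.

Lemma overlap_chart_at c x : codomain c x -> overlap c (chart_at (param c x)) x.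
Proof. by move=> cx; apply/overlapE; split=> //; exact: chart_at_domain. Qed.

(** [is_manifold] does not list this among its axioms: it follows from the continuity of [param c]
    on the open codomain and the openness of [domain d]. *)
Lemma open_overlap c d : open (overlap c d).
Proof.
have -> : overlap c d = codomain c `&` param c @^-1` domain d.
  by apply/seteqP; split=> x /overlapE.
case: hM => _ _ hc _ _.
have [_ oc _ _ cpar] := hc c; have [od _ _ _ _] := hc d.
rewrite openE => x [cx dx]; apply: filterI; first exact: open_nbhs_nbhs.
by apply: (cpar x cx); exact: open_nbhs_nbhs.
Qed.

Lemma overlap_transition c d x : overlap c d x -> overlap d c (transition c d x).
Proof. by case=> p [cp dp] <-; exists p => //; rewrite /transition /= paramK. Qed.

Lemma transitionK c d x : overlap c d x -> transition d c (transition c d x) = x.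
Proof. by case=> p [cp dp] <-; rewrite /transition /= !paramK. Qed.

Lemma param_transition c d x :
  overlap c d x -> param d (transition c d x) = param c x.
Proof. by case=> p [cp dp] <-; rewrite /transition /= !paramK. Qed.

Lemma transition_smooth c d k : of_class k (overlap c d) (transition c d).
Proof. by case: hM => _ _ _ _ /(_ c d); exact. Qed.

Lemma transition_differentiable c d x :
  overlap c d x -> differentiable (transition c d) x.
Proof. exact: (transition_smooth c d 1).1. Qed.

(** The cocycle identity between transition maps holds only where the charts overlap, but overlaps
    are open, so it can be differentiated there. *)
Lemma jacobian_transition_comp c d e x :
  overlap c d x -> overlap c e x ->
  'J (transition c e) x =
  'J (transition c d) x *m 'J (transition d e) (transition c d x).
Proof.
move=> cdx cex.
have dex : overlap d e (transition c d x).
  case: cdx => p [cp dp] pE; have [_] := (overlapE c e x).1 cex.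
  rewrite -pE paramK// => ep; exists p => //.
  by rewrite /transition /= paramK.
rewrite -jacobian_comp; [|exact: transition_differentiable..].
refine (jacobian_eq_open (@open_overlap c d) cdx _ (transition_differentiable cex)).
move=> y cdy.
by rewrite /= {2}/transition /= param_transition.
Qed.

Lemma jacobian_transition_id c x : codomain c x -> 'J (transition c c) x = 1%:M.
Proof.
move=> cx; have [d1 J1] := @jacobian_linear R _ _ 1%:M (0 : 'rV_(dim M)) x.
rewrite -[RHS]J1; apply/esym.
apply: (jacobian_eq_open (@open_codomain c) cx _ d1) => y cy.
by rewrite mulmx1 addr0 /transition /= coordsK.
Qed.

Lemma jacobian_transitionK c d x : overlap c d x ->
  'J (transition c d) x *m 'J (transition d c) (transition c d x) = 1%:M.
Proof.
move=> cdx; have [cx _] := (overlapE _ _ _).1 cdx.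
rewrite -jacobian_transition_comp//; first exact: jacobian_transition_id.
by apply/overlapE; split=> //; exact: codomain_param.
Qed.

Lemma vf_coordsE (X : vector_field M) c x : codomain c x ->
  X (param c x) = vf_coords X c x *m 'J (transition c (chart_at (param c x))) x.
Proof.
move=> cx; rewrite /vf_coords; set e := chart_at _.
have cex : overlap c e x by exact: overlap_chart_at.
have -> : base_coords (param c x) = transition c e x by [].
have := jacobian_transitionK (overlap_transition cex); rewrite (transitionK cex).
by move=> JK; rewrite -mulmxA JK mulmx1.
Qed.

(** Components in any chart come from the vector stored in [chart_at] of the point; the cocycle
    identity through that third chart gives the law between [c] and [d]. *)
Lemma vf_coords_transition (X : vector_field M) c d x : overlap c d x ->
  vf_coords X d (transition c d x) = vf_coords X c x *m 'J (transition c d) x.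
Proof.
move=> cdx; have [cx dx] := (overlapE _ _ _).1 cdx.
rewrite /vf_coords (param_transition cdx) -mulmxA; apply: (congr1 (mulmx _)).
set e := chart_at _; have cex : overlap c e x by exact: overlap_chart_at.
have -> : base_coords (param c x) = transition c e x by [].
have edx : overlap e d (transition c e x).
  apply/overlapE; rewrite (param_transition cex); split=> //.
  exact/codomain_coords/chart_at_domain.
have := jacobian_transition_comp (overlap_transition cex) edx.
by rewrite (transitionK cex).
Qed.

Lemma vf_coords_base (X : vector_field M) p :
  vf_coords X (chart_at p) (base_coords p) = X p.
Proof.
rewrite /vf_coords param_base_coords jacobian_transition_id ?mulmx1//.
exact: base_coords_codomain.
Qed.

Lemma inner_coords (g : tensor2 M) (X Y : vector_field M) c x : codomain c x ->
  inner g (X (param c x)) (Y (param c x)) =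
  (vf_coords X c x *m tensor2_coords g c x *m (vf_coords Y c x)^T) 0 0.
Proof.
move=> cx; rewrite /inner (vf_coordsE X cx) (vf_coordsE Y cx).
exact: (congr1 (fun N : 'M[R]_1 => N 0 0) (mulmx_congruence _ _ _ _)).
Qed.

Lemma tensor2_coords_base (g : tensor2 M) p :
  tensor2_coords g (chart_at p) (base_coords p) = g p.
Proof.
rewrite /tensor2_coords param_base_coords jacobian_transition_id.
  by rewrite trmx1 mul1mx mulmx1.
exact: base_coords_codomain.
Qed.

Lemma act_coords (X : vector_field M) (f : M -> R) c x :
  smooth_fun f -> codomain c x ->
  act X f (param c x) = 'D_(vf_coords X c x) (f \o param c) x.
Proof.
move=> sf cx; rewrite /act /differential (vf_coordsE X cx).
set e := chart_at _; have cex : overlap c e x by exact: overlap_chart_at.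
have -> : base_coords (param c x) = transition c e x by [].
have df : differentiable (f \o param e) (transition c e x).
  apply: (sf e 1).1; have /overlapE := overlap_transition cex; by case.
rewrite -(deriveE _ df) -(derive_comp_along _ (transition_differentiable cex) df).
refine (derive_eq_open _ (@open_overlap c e) cex _) => y cey.
by rewrite /= param_transition.
Qed.

Definition bracket_coords (X Y : vector_field M) c x : 'rV[R]_(dim M) :=
  'D_(vf_coords X c x) (vf_coords Y c) x - 'D_(vf_coords Y c x) (vf_coords X c) x.

(** The law Y_d(T) = Y_c J(T), with T the transition map, is differentiated along X. The product
    rule leaves, besides the tensorial term, a second derivative of T along X and Y. *)
Lemma derive_vf_coords_transition (X Y : vector_field M) c d x :
  smooth_vf Y -> overlap c d x ->
  'D_(vf_coords X d (transition c d x)) (vf_coords Y d) (transition c d x) =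
  'D_(vf_coords X c x) (vf_coords Y c) x *m 'J (transition c d) x
  + 'D_(vf_coords X c x) ('D_(vf_coords Y c x) (transition c d)) x.
Proof.
move=> sY cdx; have [cx dx] := (overlapE _ _ _).1 cdx.
rewrite vf_coords_transition//; set u := vf_coords X c x.
have [dcx _] := (overlapE _ _ _).1 (overlap_transition cdx).
have dT := transition_differentiable cdx.
have dYd : differentiable (vf_coords Y d) (transition c d x).
  exact: (sY d 1%N).1.
refine (etrans (esym (derive_comp_along u dT dYd)) _).
have dY : differentiable (vf_coords Y c) x by apply: (sY c 1%N).1.
have CJ : of_class 1 (overlap c d) (jacobian (transition c d)).
  by apply: of_class_jacobian; [exact: open_overlap | exact: transition_smooth].
have dJ : differentiable (jacobian (transition c d)) x by apply: CJ.1.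
refine (etrans (derive_eq_open u (@open_overlap c d) cdx
  (fun y cdy => vf_coords_transition Y cdy)) _).
refine (etrans (derive_mulmx (diff_derivable dY) (diff_derivable dJ)) _).
apply: (congr1 (fun w => 'D_u (vf_coords Y c) x *m 'J (transition c d) x + w)).
(* With the vector [vf_coords Y c x] frozen, the derivative of the Jacobian applied to it is an
   iterated directional derivative of the transition map, the form in which Schwarz's theorem is
   stated. *)
refine (etrans (esym (derive_mulmxl _ (diff_derivable dJ))) _).
refine (derive_eq_open u (@open_overlap c d) cdx _) => y cdy.
by apply/esym/deriveEjacobian; exact: transition_differentiable.
Qed.

(** The non-tensorial terms of the two transformation laws are the second derivatives of the
    transition map in the two orders; they cancel by [derive_comm_mx]. *)
Lemma bracket_coords_transition (X Y : vector_field M) c d x :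
  smooth_vf X -> smooth_vf Y -> overlap c d x ->
  bracket_coords X Y d (transition c d x) =
  bracket_coords X Y c x *m 'J (transition c d) x.
Proof.
have subr_shift (a b a' b' s s' : 'rV[R]_(dim M)) (J : 'M[R]_(dim M)) : s = s' ->
    a = a' *m J + s -> b = b' *m J + s' -> a - b = (a' - b') *m J.
  by move=> -> -> ->; rewrite mulmxBl opprD addrACA subrr addr0.
move=> sX sY cdx.
exact: subr_shift
  (derive_comm_mx (vf_coords X c x) (vf_coords Y c x)
     (@open_overlap c d) (transition_smooth c d 2) cdx)
  (derive_vf_coords_transition X sY cdx) (derive_vf_coords_transition Y sX cdx).
Qed.

(** By definition the bracket at a point is [bracket_coords] in [chart_at] of that point, a chart
    that may jump from point to point. The transformation law carries it to the fixed chart [c],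
    where smoothness can be tested. *)
Lemma vf_coords_bracket (X Y : vector_field M) c x :
  smooth_vf X -> smooth_vf Y -> codomain c x ->
  vf_coords (bracket X Y) c x = bracket_coords X Y c x.
Proof.
move=> sX sY cx; rewrite /vf_coords.
set p := param c x; set e := chart_at p.
have cex : overlap c e x by exact: overlap_chart_at.
have ecx := overlap_transition cex.
have bE : bracket X Y p = bracket_coords X Y e (transition c e x).
  by rewrite /bracket_coords !vf_coords_base.
refine (etrans (congr1 (fun w => w *m _) bE) _).
refine (etrans (esym (bracket_coords_transition sX sY ecx)) _).
exact: (congr1 (bracket_coords X Y c) (transitionK cex)).
Qed.

Lemma smooth_bracket (X Y : vector_field M) :
  smooth_vf X -> smooth_vf Y -> smooth_vf (bracket X Y).
Proof.
move=> sX sY c k; have oC := @open_codomain c.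
have H : of_class k (codomain c) (bracket_coords X Y c).
  have H1 := of_class_derive_along_mx oC (sX c k) (sY c k.+1).
  have H2 := of_class_derive_along_mx oC (sY c k) (sX c k.+1).
  have H3 : of_class k (codomain c)
      (fun x => -1 *: 'D_(vf_coords Y c x) (vf_coords X c) x).
    by apply: of_classZ => //; exact: of_class_cst.
  by apply: of_class_eq (of_classD oC H1 H3) => // x _; rewrite scaleN1r.
by apply: of_class_eq H => // x /[!inE] cx; rewrite vf_coords_bracket.
Qed.

Lemma smooth_inner (g : tensor2 M) (X Y : vector_field M) :
  smooth_tensor2 g -> smooth_vf X -> smooth_vf Y ->
  smooth_fun (fun p => inner g (X p) (Y p)).
Proof.
move=> sg sX sY c k; have oC := @open_codomain c.
have H := of_class_entry 0 0 oC (of_class_mulmx oC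
  (of_class_mulmx oC (sX c k) (sg c k)) (of_class_trmx oC (sY c k))).
by apply: of_class_eq H => // x /[!inE] cx; rewrite -inner_coords.
Qed.

Lemma smooth_act (X : vector_field M) (f : M -> R) :
  smooth_vf X -> smooth_fun f -> smooth_fun (act X f).
Proof.
move=> sX sf c k; have oC := @open_codomain c.
have H := of_class_derive_along oC (sX c k) (sf c k.+1).
by apply: of_class_eq H => // x /[!inE] cx; rewrite -act_coords.
Qed.

Lemma smooth_koszul (g : tensor2 M) (X Y Z : vector_field M) :
  smooth_tensor2 g -> smooth_vf X -> smooth_vf Y -> smooth_vf Z ->
  smooth_fun (koszul g X Y Z).
Proof.
move=> sg sX sY sZ c k; have oC := @open_codomain c.
have sip U V : smooth_vf U -> smooth_vf V ->
    smooth_fun (fun p => inner g (U p) (V p)) by exact: smooth_inner.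
have sD (f h : M -> R) : smooth_fun f -> smooth_fun h -> smooth_fun (fun p => f p + h p).
  by move=> sf sh c' k'; apply: of_classD; [exact: open_codomain | exact: sf | exact: sh].
have sB (f h : M -> R) : smooth_fun f -> smooth_fun h -> smooth_fun (fun p => f p - h p).
  move=> sf sh c' k'; have oC' := @open_codomain c'.
  have H := of_classD oC' (sf c' k')
    (of_classM oC' (of_class_cst k' (codomain c') (-1 : R)) (sh c' k')).
  by apply: of_class_eq H => // x _; rewrite /= mulN1r.
apply: (of_classM oC (of_class_cst k (codomain c) (2^-1 : R))).
have sA U V W : smooth_vf U -> smooth_vf V -> smooth_vf W ->
    smooth_fun (act U (fun p => inner g (V p) (W p))).
  by move=> sU sV sW; apply: smooth_act => //; exact: sip.
have sb U V W : smooth_vf U -> smooth_vf V -> smooth_vf W ->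
    smooth_fun (fun p => inner g (U p) (bracket V W p)).
  by move=> sU sV sW; apply: sip => //; exact: smooth_bracket.
exact: (sD _ _ (sD _ _ (sB _ _ (sB _ _ (sD _ _ (sA _ _ _ sX sY sZ) (sA _ _ _ sY sZ sX))
  (sA _ _ _ sZ sX sY)) (sb _ _ _ sX sY sZ)) (sb _ _ _ sY sZ sX))
  (sb _ _ _ sZ sX sY) c k).
Qed.

End Charts.

(** * The Koszul form in a chart *)

(** [b] stands for the metric at a point, [dxy] for the derivative of Y along X, and [t1], [t2],
    [t3] for the derivatives of the metric tensor. The bracket terms cancel every derivative of a
    field except two copies of [b dxy z]. *)
Lemma koszul_identity (R : realFieldType) (V : zmodType) (b : V -> V -> R)
    (x y z dxy dxz dyx dyz dzx dzy : V) (t1 t2 t3 : R) :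
  (forall u v, b u v = b v u) -> (forall u v w, b u (v - w) = b u v - b u w) ->
  2^-1 * (b dxy z + t1 + b y dxz + (b dyz x + t2 + b z dyx)
          - (b dzx y + t3 + b x dzy)
          - b x (dyz - dzy) + b y (dzx - dxz) + b z (dxy - dyx))
  = b dxy z + 2^-1 * (t1 + t2 - t3).
Proof.
move=> bC bB; rewrite !bB (bC x dyz) (bC dzx) (bC z dxy).
by field.
Qed.

Section KoszulExpansion.
Context {R : realType} (M : atlas_space R) (hM : is_manifold M).
Implicit Types (g : tensor2 M) (X Y Z : vector_field M).

(** Components are differentiated in the single chart [chart_at p], so neither this nor [deriv_vf]
    is tensorial; they acquire an invariant meaning in the combination of [koszulE]. *)
Definition deriv_tensor2 g (p : M) (v : 'rV[R]_(dim M)) : 'M[R]_(dim M) :=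
  'D_v (tensor2_coords g (chart_at p)) (base_coords p).

Definition deriv_vf Y (p : M) (v : 'rV[R]_(dim M)) : 'rV[R]_(dim M) :=
  'D_v (vf_coords Y (chart_at p)) (base_coords p).

(* The Christoffel symbols of the first kind in the chart [chart_at p]. *)
Definition christoffel g (p : M) (u v w : 'rV[R]_(dim M)) : R :=
  2^-1 * ((v *m deriv_tensor2 g p u *m w^T) 0 0
          + (w *m deriv_tensor2 g p v *m u^T) 0 0
          - (u *m deriv_tensor2 g p w *m v^T) 0 0).

Lemma act_inner g X Y Z p :
  smooth_tensor2 g -> smooth_vf Y -> smooth_vf Z ->
  act X (fun q => inner g (Y q) (Z q)) p =
  inner g (p := p) (deriv_vf Y p (X p)) (Z p)
  + (Y p *m deriv_tensor2 g p (X p) *m (Z p)^T) 0 0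
  + inner g (p := p) (Y p) (deriv_vf Z p (X p)).
Proof.
move=> sg sY sZ; set c := chart_at p; set x := base_coords p.
have cx : codomain c x by exact: base_coords_codomain.
have oC := @open_codomain _ _ hM c.
have sf := smooth_inner hM sg sY sZ.
refine (etrans (esym (deriveE (X p) ((sf c 1%N).1 x cx))) _).
pose F y := vf_coords Y c y *m tensor2_coords g c y *m (vf_coords Z c y)^T.
refine (etrans (derive_eq_open (X p) (g := fun y => F y 0 0) oC cx
  (fun y cy => inner_coords hM g Y Z cy)) _).
have dY : derivable (vf_coords Y c) x (X p).
  by apply: diff_derivable; exact: (sY c 1%N).1.
have dZ : derivable (vf_coords Z c) x (X p).
  by apply: diff_derivable; exact: (sZ c 1%N).1.
have dG : derivable (tensor2_coords g c) x (X p).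
  by apply: diff_derivable; exact: (sg c 1%N).1.
have dYG := derivable_mulmx dY dG; have dZt := derivable_trmx dZ.
refine (etrans (esym (derive_entry 0 0 (derivable_mulmx dYG dZt))) _).
have FE : 'D_(X p) F x =
    (deriv_vf Y p (X p) *m g p + Y p *m deriv_tensor2 g p (X p)) *m (Z p)^T
    + Y p *m g p *m (deriv_vf Z p (X p))^T.
  refine (etrans (derive_mulmx dYG dZt) _).
  rewrite (derive_mulmx dY dG) (derive_trmx dZ).
  by rewrite !vf_coords_base// tensor2_coords_base.
have entryD (A B : 'M[R]_1) : (A + B) 0 0 = A 0 0 + B 0 0 by rewrite mxE.
by rewrite FE mulmxDl !entryD.
Qed.

Lemma inner_sym g p (u v : tangent p) :
  (forall q, (g q)^T = g q) -> inner g u v = inner g v u.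
Proof.
move=> sg; rewrite /inner.
have -> : u *m g p *m v^T = (v *m g p *m u^T)^T.
  by rewrite !trmx_mul trmxK sg mulmxA.
by rewrite mxE.
Qed.

Lemma innerBr g p (u v w : tangent p) :
  inner g u (v - w : tangent p) = inner g u v - inner g u w.
Proof. by rewrite /inner linearB mulmxBr !mxE. Qed.

(** The Leibniz rule [act_inner] is inserted in each of the three derivative terms. The result shows
    that [Z] enters only through its value at [p], so that representing K(X, Y, .) is a pointwise
    problem. *)
Lemma koszulE g X Y Z p :
  (forall q, (g q)^T = g q) -> smooth_tensor2 g ->
  smooth_vf X -> smooth_vf Y -> smooth_vf Z ->
  koszul g X Y Z p = inner g (p := p) (deriv_vf Y p (X p)) (Z p)
                     + christoffel g p (X p) (Y p) (Z p).
Proof.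
move=> symg sg sX sY sZ; rewrite /koszul.
rewrite (act_inner X p sg sY sZ) (act_inner Y p sg sZ sX) (act_inner Z p sg sX sY).
refine (@koszul_identity R 'rV[R]_(dim M) (@inner R M g p)
  (X p) (Y p) (Z p) (deriv_vf Y p (X p)) (deriv_vf Z p (X p))
  (deriv_vf X p (Y p)) (deriv_vf Z p (Y p)) (deriv_vf X p (Z p)) (deriv_vf Y p (Z p))
  _ _ _ _ (@innerBr g p)) => u v.
exact: inner_sym.
Qed.

End KoszulExpansion.

(** * Projections and slices of a product *)

(* In matching charts [pi] is the linear map [P]. *)
Record chart_projection {R : realType} (M N : atlas_space R) (pi : M -> N)
    (kappa : chart M -> chart N) (P : 'M[R]_(dim M, dim N)) : Prop := {
  proj_chart_at : forall p, kappa (chart_at p) = chart_at (pi p);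
  proj_domain : forall c p, domain c p -> domain (kappa c) (pi p);
  proj_coords : forall c p, coords c p *m P = coords (kappa c) (pi p);
  proj_param : forall c x, pi (param c x) = param (kappa c) (x *m P)
}.

(* In matching charts [iota], a section of [pi], is the map [h]. *)
Record chart_slice {R : realType} (M N : atlas_space R) (pi : M -> N)
    (kappa : chart M -> chart N) (iota : N -> M) (lam : chart N -> chart M)
    (h : 'rV[R]_(dim N) -> 'rV[R]_(dim M)) : Prop := {
  slice_proj : forall q, pi (iota q) = q;
  slice_chart : forall c, kappa (lam c) = c;
  slice_domain : forall c q, domain c q -> domain (lam c) (iota q);
  slice_coords : forall c q, coords (lam c) (iota q) = h (coords c q);
  slice_smooth : forall k, of_class k setT h
}.

Section Projection.
Context {R : realType} (M N : atlas_space R) (hM : is_manifold M)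
  (hN : is_manifold N) (pi : M -> N) (kappa : chart M -> chart N)
  (P : 'M[R]_(dim M, dim N)) (hpi : chart_projection pi kappa P).
Implicit Types (c d : chart M) (p : M).

Lemma proj_codomain c x : codomain c x -> codomain (kappa c) (x *m P).
Proof.
case=> p cp <-; rewrite (proj_coords hpi).
exact/codomain_coords/(proj_domain hpi).
Qed.

Lemma proj_base_coords p : base_coords p *m P = base_coords (pi p).
Proof. by rewrite /base_coords (proj_coords hpi) (proj_chart_at hpi). Qed.

Lemma proj_overlap c d x :
  overlap c d x -> overlap (kappa c) (kappa d) (x *m P).
Proof.
case=> p [cp dp] <-; rewrite (proj_coords hpi).
by exists (pi p) => //; split; exact: (proj_domain hpi).
Qed.

Lemma proj_transition c d x :
  transition c d x *m P = transition (kappa c) (kappa d) (x *m P).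
Proof. by rewrite /transition /= (proj_coords hpi) (proj_param hpi). Qed.

Lemma differentiable_mulmxr n m (A : 'M[R]_(n, m)) (x : 'rV[R]_n) :
  differentiable (fun y : 'rV[R]_n => y *m A) x.
Proof.
have [d _] := jacobian_linear A 0 x.
by move: d; under eq_fun do rewrite addr0.
Qed.

Lemma jacobian_mulmxr n m (A : 'M[R]_(n, m)) (x : 'rV[R]_n) :
  'J (fun y : 'rV[R]_n => y *m A) x = A.
Proof.
have [_ J] := jacobian_linear A 0 x.
by move: J; under eq_fun do rewrite addr0.
Qed.

(** Both sides are Jacobians of one map: by [proj_transition], changing chart and then projecting is
    projecting and then changing chart. *)
Lemma jacobian_transition_proj c d x : overlap c d x ->
  'J (transition c d) x *m P =
  P *m 'J (transition (kappa c) (kappa d)) (x *m P).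
Proof.
move=> cdx; have dT := transition_differentiable hM cdx.
have dT' := transition_differentiable hN (proj_overlap cdx).
have dP := differentiable_mulmxr P.
have E1 := jacobian_comp dT (dP (transition c d x)).
have E2 := jacobian_comp (dP x) dT'.
rewrite jacobian_mulmxr in E1; rewrite jacobian_mulmxr in E2.
refine (etrans (esym E1) (etrans _ E2)).
apply: (congr1 (fun F => jacobian F x)); apply/funext => y.
exact: proj_transition.
Qed.

Lemma tangent_map_proj p : tangent_map pi p = P.
Proof.
refine (etrans _ (jacobian_mulmxr P (base_coords p))); apply: esym.
refine (jacobian_eq_open (@open_codomain _ _ hM (chart_at p))
  (base_coords_codomain hM p) _ (differentiable_mulmxr P _)) => y cy /=.
by rewrite -(proj_chart_at hpi) -(proj_coords hpi) coordsK.
Qed.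

Lemma pullback_coords (g : tensor2 N) c x : codomain c x ->
  tensor2_coords (pullback pi g) c x =
  P *m tensor2_coords g (kappa c) (x *m P) *m P^T.
Proof.
have congruence (J : 'M[R]_(dim M)) (J' G : 'M[R]_(dim N)) : J *m P = P *m J' ->
    J *m (P *m G *m P^T) *m J^T = P *m (J' *m G *m J'^T) *m P^T.
  move=> E; have -> : J *m (P *m G *m P^T) *m J^T = (J *m P) *m G *m (J *m P)^T.
    by rewrite trmx_mul !mulmxA.
  by rewrite E trmx_mul !mulmxA.
move=> cx; have cex := overlap_chart_at hM cx.
rewrite /tensor2_coords /pullback tangent_map_proj -(proj_param hpi).
rewrite -(proj_chart_at hpi); exact: congruence (jacobian_transition_proj cex).
Qed.

Section Slice.
Context (iota : N -> M) (lam : chart N -> chart M)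
  (h : 'rV[R]_(dim N) -> 'rV[R]_(dim M))
  (hi : chart_slice pi kappa iota lam h).

(** [P] acts on components in [chart_at (iota q)]; its product is a vector in the frame of
    [chart_at q], because [kappa] sends the first chart to the second. *)
Definition slice_vf (X : vector_field M) : vector_field N :=
  fun q => (X (iota q) : 'rV_(dim M)) *m P.

Lemma slice_vf_coords (X : vector_field M) (c : chart N) y : codomain c y ->
  vf_coords (slice_vf X) c y = vf_coords X (lam c) (h y) *m P.
Proof.
case=> q cq <-; rewrite /vf_coords (paramK hN cq).
rewrite -(slice_coords hi) (paramK hM (slice_domain hi cq)).
rewrite /slice_vf; set p := iota q; set e := chart_at p.
have ep : domain e p by exact: chart_at_domain.
have ecx : overlap e (lam c) (base_coords p).
  by exists p => //; split=> //; exact: (slice_domain hi).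
have := jacobian_transition_proj ecx.
rewrite proj_base_coords (slice_chart hi) (proj_chart_at hpi) (slice_proj hi).
move: ('J _ _) ('J _ _) => J J' E.
by rewrite -!mulmxA E.
Qed.

Lemma smooth_slice_vf (X : vector_field M) : smooth_vf X -> smooth_vf (slice_vf X).
Proof.
move=> sX c k; have oC := @open_codomain _ _ hN c.
have oD := @open_codomain _ _ hM (lam c).
have CD y : codomain c y -> codomain (lam c) (h y).
  case=> q cq <-; rewrite -(slice_coords hi).
  exact/codomain_coords/(slice_domain hi).
have H := of_class_mulmx oC
  (of_class_comp oC oD CD (of_class_sub (fun _ _ => I) (slice_smooth hi k)) (sX _ k))
  (of_class_cst k (codomain c) P).
by apply: of_class_eq H => // y /[!inE] cy; rewrite slice_vf_coords.
Qed.

End Slice.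
End Projection.

Section ChristoffelDual.
Context {R : realType}.

(** Radical-stationarity of [g], applied to the slice fields, gives a vector representing their
    Koszul form; subtracting the [deriv_vf] summand of [koszulE] leaves one representing the
    Christoffel part. *)
Lemma christoffel_dual (M N : atlas_space R) (hM : is_manifold M) (pi : M -> N)
    (kappa : chart M -> chart N) (P : 'M[R]_(dim M, dim N))
    (iota : N -> M) (lam : chart N -> chart M)
    (h : 'rV[R]_(dim N) -> 'rV[R]_(dim M)) (g : tensor2 N)
    (X Y : vector_field M) (p : M) :
  chart_projection pi kappa P -> chart_slice pi kappa iota lam h ->
  iota (pi p) = p -> radical_stationary g -> smooth_vf X -> smooth_vf Y ->
  exists u : tangent (pi p), forall Z : vector_field M, smooth_vf Z ->
    christoffel g (pi p) ((X p : 'rV_(dim M)) *m P) ((Y p : 'rV_(dim M)) *m P)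
      ((Z p : 'rV_(dim M)) *m P)
    = inner g u (((Z p : 'rV_(dim M)) *m P) : tangent (pi p)).
Proof.
move=> hpi hi ip [[hN symg sg] hK] sX sY.
have sS := smooth_slice_vf hM hN hpi hi.
have [w [_ /(_ (pi p))[u uE]] wK] := hK _ _ (sS _ sX) (sS _ sY).
(* The spaces [tangent q] are one and the same row space for all [q], so the equality
   [iota (pi p) = p] is applied without transport. *)
have vE (V : vector_field M) :
    slice_vf P iota V (pi p) = (V p : 'rV_(dim M)) *m P.
  exact: (congr1 (fun q => (V q : 'rV_(dim M)) *m P) ip).
pose u' : tangent (pi p) :=
  u - deriv_vf (slice_vf P iota Y) (pi p) (slice_vf P iota X (pi p)).
exists u' => Z sZ.
have := wK _ (sS _ sZ) (pi p).
rewrite (koszulE hN (pi p) symg sg (sS _ sX) (sS _ sY) (sS _ sZ)) uE.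
rewrite /u' !vE => E.
rewrite (inner_sym (_ - _ : tangent _) _ symg) innerBr.
rewrite ![inner g (_ *m P : tangent _) _](inner_sym _ _ symg) -E.
by rewrite addrC addKr.
Qed.

End ChristoffelDual.

(** * Product topologies *)

Section ProductTopology.
Context {l : nat} (K : 'I_l -> topologicalType).

Lemma continuous_proj (j : 'I_l) : continuous (fun q : prod_topology K => q j).
Proof. exact: (@proj_continuous _ K j). Qed.

Lemma continuous_prod (T : topologicalType) (f : T -> prod_topology K) (x : T) :
  (forall j, {for x, continuous (fun y => f y j)}) -> {for x, continuous f}.
Proof.
move=> cf; apply/cvg_sup => j A [B [[C oC <-] /= Cfx] CA].
apply: filterS CA _; apply: (cf j); exact: open_nbhs_nbhs.
Qed.

(** The product topology is the supremum of those induced by the projections, so it suffices that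
    the filter generated by boxes around [q] converges to [q] for each of them. *)
Lemma nbhs_prod_cylinder (q : prod_topology K) (A : set (prod_topology K)) :
  nbhs q A -> exists2 U : forall j, set (K j), (forall j, nbhs (q j) (U j)) &
    [set q' | forall j, U j (q' j)] `<=` A.
Proof.
pose F : set_system (prod_topology K) := filter_from
  [set U : forall j, set (K j) | forall j, nbhs (q j) (U j)]
  (fun U => [set q' | forall j, U j (q' j)]).
have FF : Filter F.
  apply: filter_from_filter; first by exists (fun j => setT) => j; exact: filterT.
  move=> U V HU HV; exists (fun j => U j `&` V j).
    by move=> j; apply: filterI; [exact: HU | exact: HV].
  by move=> q' HUV; split=> j; case: (HUV j).
suff : F --> q by move=> Fq /Fq[U HU UA]; exists U.
apply/cvg_sup => j A' [B [[C oC <-] /= Cq] CA].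
(* The box that is [C] in direction [j] and the whole space in the others. *)
exists (dfwith (fun j => setT) j C).
  move=> k; case: dfwithP => [|k' _]; last exact: filterT.
  exact: open_nbhs_nbhs.
by move=> q' /(_ j); rewrite dfwithin => ?; exact: CA.
Qed.

(** A box is the intersection of the preimages of its sides under the projections, finitely many
    because the index type is ['I_l]. *)
Lemma open_cylinder (U : forall j, set (K j)) :
  (forall j, open (U j)) -> open [set q : prod_topology K | forall j, U j (q j)].
Proof.
move=> oU; rewrite openE => q Uq.
apply: (@filter_forall _ _ (fun j => [set q' : prod_topology K | U j (q' j)])
  (nbhs q) (nbhs_filter q)) => j.
exact: (@continuous_proj j q _ (open_nbhs_nbhs (conj (oU j) (Uq j)))).
Qed.

Lemma second_countable_prod_topology :
  (forall j, @second_countable (K j)) -> @second_countable (prod_topology K).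
Proof.
move=> sc; pose f j := s2val (cid2 (sc j)).
have cf j : countable (f j) := s2valP (cid2 (sc j)).
have bf j : basis (f j) := s2valP' (cid2 (sc j)).
exists [set A | exists2 U : forall j, set (K j), (forall j, f j (U j)) &
  A = [set q | forall j, U j (q j)]].
  pose e j := sval (cid (elimT (countable_injP (f j)) (cf j))).
  have He j : {in f j &, injective (e j)} :=
    svalP (cid (elimT (countable_injP (f j)) (cf j))).
  pose D := [set U : forall j, set (K j) | forall j, f j (U j)].
  (* Through the injections [e j] of the bases into the integers, a family of basic sets is coded by
     a finite function from ['I_l] to integers, hence by one integer. *)
  have cD : countable D.
    apply/countable_injP; exists (fun U => pickle [ffun j => e j (U j)]).
    move=> U V /[!inE] DU DV /(pcan_inj pickleK)/ffunP UV.
    apply: functional_extensionality_dep => j.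
    by apply: He; rewrite ?inE//; have := UV j; rewrite !ffunE.
  have -> : [set A | exists2 U : forall j, set (K j), (forall j, f j (U j)) &
      A = [set q | forall j, U j (q j)]] =
      (fun U => [set q : prod_topology K | forall j, U j (q j)]) @` D.
    by apply/seteqP; split=> A [U DU UA]; exists U.
  exact: sub_countable (card_image_le _ _) cD.
split=> [A [U fU ->]|q A qA].
  by apply: open_cylinder => j; case: (bf j) => + _; apply; exact: fU.
have [U HU UA] := nbhs_prod_cylinder qA.
have exV (j : 'I_l) : exists V, [/\ f j V, V (q j) & V `<=` U j].
  by case: (bf j) => _ /(_ (q j) _ (HU j))[V [fV Vq] VU]; exists V.
pose V j := sval (cid (exV j)).
have HV j : [/\ f j (V j), V j (q j) & V j `<=` U j] := svalP (cid (exV j)).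
exists [set q | forall j, V j (q j)].
  split; last by move=> j; case: (HV j).
  by exists V => // j; case: (HV j).
by move=> q' Vq'; apply: UA => j; case: (HV j) => _ _; apply; exact: Vq'.
Qed.

End ProductTopology.

Lemma hausdorff_pair (T S : topologicalType) :
  hausdorff_space T -> hausdorff_space S -> hausdorff_space (T * S)%type.
Proof.
move=> hT hS [a b] [c d] H; congr pair.
- apply: hT => A B Aa Bc.
  have [|| [x y] [/= [Ax _] [Bx _]]] := H (A `*` setT) (B `*` setT).
  + by exists (A, setT) => //=; split => //; exact: filterT.
  + by exists (B, setT) => //=; split => //; exact: filterT.
  by exists x.
- apply: hS => A B Aa Bc.
  have [|| [x y] [/= [_ Ax] [_ Bx]]] := H (setT `*` A) (setT `*` B).
  + by exists (setT, A) => //=; split => //; exact: filterT.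
  + by exists (setT, B) => //=; split => //; exact: filterT.
  by exists y.
Qed.

Lemma second_countable_pair (T S : topologicalType) :
  @second_countable T -> @second_countable S -> @second_countable (T * S)%type.
Proof.
move=> [BT cT [oT nT]] [BS cS [oS nS]].
exists [set A | exists2 U, (BT `*` BS) U & A = U.1 `*` U.2].
  have -> : [set A | exists2 U, (BT `*` BS) U & A = U.1 `*` U.2] =
      (fun U => U.1 `*` U.2) @` (BT `*` BS).
    by apply/seteqP; split=> A [U BU UA]; exists U.
  exact: sub_countable (card_image_le _ _) (countableX cT cS).
split=> [A [[U V] [/= BU BV] ->]|[a b] A [[U V] /= [Ua Vb] UVA]].
  rewrite openE => -[a b] [/= Ua Vb]; exists (U, V) => //=.
  by split; apply: open_nbhs_nbhs; split=> //; [exact: oT|exact: oS].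
have [U' [BU Ua'] UU] := nT _ _ Ua; have [V' [BV Vb'] VV] := nS _ _ Vb.
exists (U' `*` V').
  by split=> //; exists (U', V').
by move=> [x y] [/= Ux Vy]; apply: UVA; split; [exact: UU|exact: VV].
Qed.

(** * The product manifold *)

Section ProductManifold.
Context {R : realType} {l : nat} (B : atlas_space R) (F : 'I_l -> atlas_space R).
Notation PM := (prod_manifold B F).
Notation fdim := (\sum_(j < l) dim (F j))%N.

(** Block extraction is written as a matrix product so that the rules for Jacobians and derivatives
    of [*m] apply to it, and so that the base and the fibers are instances of one
    [chart_projection]. *)
Definition base_mx : 'M[R]_(dim PM, dim B) :=
  (col_mx 1%:M 0 : 'M[R]_(dim B + fdim, dim B)).

Definition fiber_mx (j : 'I_l) : 'M[R]_(dim PM, dim (F j)) :=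
  (col_mx 0 (submxrow (1%:M : 'M[R]_(fdim)) j) : 'M[R]_(dim B + fdim, dim (F j))).

Lemma mul_base_mx (x : 'rV[R]_(dim PM)) :
  x *m base_mx = lsubmx (x : 'rV_(dim B + fdim)).
Proof.
rewrite -[X in X *m _](hsubmxK (x : 'rV_(dim B + fdim))) /base_mx mul_row_col.
by rewrite mulmx1 mulmx0 addr0.
Qed.

Lemma mul_fiber_mx (x : 'rV[R]_(dim PM)) (j : 'I_l) :
  x *m fiber_mx j = submxrow (rsubmx (x : 'rV_(dim B + fdim))) j.
Proof.
rewrite -[X in X *m _](hsubmxK (x : 'rV_(dim B + fdim))) /fiber_mx mul_row_col.
by rewrite mulmx0 add0r mul_submxrow mulmx1.
Qed.

Lemma base_projection : @chart_projection R PM B (@proj_base R l B F)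
  (fun c : prod_chart B F => c.1) base_mx.
Proof.
split=> //=.
- by move=> c p [].
- by move=> c p; rewrite mul_base_mx row_mxKl.
- by move=> c x; rewrite mul_base_mx.
Qed.

Lemma fiber_projection (j : 'I_l) : @chart_projection R PM (F j)
  (@proj_fiber R l B F j) (fun c : prod_chart B F => c.2 j) (fiber_mx j).
Proof.
split=> //=.
- by move=> c p [].
- by move=> c p; rewrite mul_fiber_mx row_mxKr mxrowK.
- by move=> c x; rewrite mul_fiber_mx.
Qed.

Lemma prod_mxP (x y : 'rV[R]_(dim PM)) : x *m base_mx = y *m base_mx ->
  (forall j, x *m fiber_mx j = y *m fiber_mx j) -> x = y.
Proof.
rewrite !mul_base_mx => xyB xyF.
rewrite -(hsubmxK (x : 'rV_(dim B + fdim))) -(hsubmxK (y : 'rV_(dim B + fdim))).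
rewrite xyB; congr row_mx; apply/mxrowP => j.
by have := xyF j; rewrite !mul_fiber_mx.
Qed.

Lemma prod_coords_base (c : chart PM) (p : PM) :
  coords c p *m base_mx = coords c.1 p.1.
Proof. exact: (proj_coords base_projection). Qed.

Lemma prod_coords_fiber (c : chart PM) (p : PM) j :
  coords c p *m fiber_mx j = coords (c.2 j) (p.2 j).
Proof. exact: (proj_coords (fiber_projection j)). Qed.

Lemma prod_coords_image (c : chart PM) (A : set B) (AF : forall j, set (F j))
    (x : 'rV[R]_(dim PM)) :
  (coords c @` [set p : PM | A p.1 /\ forall j, AF j (p.2 j)]) x <->
  (coords c.1 @` A) (x *m base_mx) /\
  forall j, (coords (c.2 j) @` AF j) (x *m fiber_mx j).
Proof.
split=> [[p [pB pF] <-]|[[pB ApB xB] xF]].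
  split=> [|j]; first by rewrite prod_coords_base; exists p.1.
  by rewrite prod_coords_fiber; exists (p.2 j).
(* A point of the product contains a function of [j], so preimages in all the fibers are chosen at
   once. *)
exists (pB, fun j => s2val (cid2 (xF j))).
  by split=> //= j; exact: s2valP (cid2 (xF j)).
apply: prod_mxP => [|j]; first by rewrite prod_coords_base.
by rewrite prod_coords_fiber; exact: s2valP' (cid2 (xF j)).
Qed.

Lemma continuous_mulmxr n m (A : 'M[R]_(n, m)) :
  continuous (fun x : 'rV[R]_n => x *m A).
Proof. by move=> x; exact/differentiable_continuous/differentiable_mulmxr. Qed.

Lemma open_prod_coords (U : set 'rV[R]_(dim B)) (V : forall j, set 'rV[R]_(dim (F j))) :
  open U -> (forall j, open (V j)) ->
  open [set x : 'rV[R]_(dim PM) | U (x *m base_mx) /\ forall j, V j (x *m fiber_mx j)].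
Proof.
move=> oU oV; rewrite openE => x [xU xV].
apply: filterI.
  exact: (continuous_mulmxr (open_nbhs_nbhs (conj oU xU))).
apply: (@filter_forall _ _
  (fun j => [set x : 'rV[R]_(dim PM) | V j (x *m fiber_mx j)])
  (nbhs x) (nbhs_filter x)) => j.
exact: (continuous_mulmxr (open_nbhs_nbhs (conj (oV j) (xV j)))).
Qed.

(** Reduces continuity and smoothness of maps into the coordinate space of the product to their
    blocks, entry by entry. *)
Lemma prod_entry (s : 'I_(dim PM)) :
  (exists t, forall x : 'rV[R]_(dim PM), x 0 s = (x *m base_mx) 0 t) \/
  (exists j t, forall x : 'rV[R]_(dim PM), x 0 s = (x *m fiber_mx j) 0 t).
Proof.
case: (split_ordP (s : 'I_(dim B + fdim))) => t ->.
  by left; exists t => x; rewrite mul_base_mx mxE.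
right; exists (tagnat.sig1 t), (tagnat.sig2 t) => x.
by rewrite mul_fiber_mx !mxE tagnat.sig2K.
Qed.

Lemma of_class_prod n k (U : set 'rV[R]_n) (f : 'rV[R]_n -> 'rV[R]_(dim PM)) :
  open U -> of_class k U (fun y => f y *m base_mx) ->
  (forall j, of_class k U (fun y => f y *m fiber_mx j)) -> of_class k U f.
Proof.
move=> oU fB fF; apply: of_class_mx => // i s; rewrite (ord1 i).
case: (prod_entry s) => [[t E]|[j [t E]]].
  by apply: of_class_eq (of_class_entry 0 t oU fB) => // y _; rewrite E.
by apply: of_class_eq (of_class_entry 0 t oU (fF j)) => // y _; rewrite E.
Qed.

Lemma continuous_at_ext (T S : topologicalType) (f g : T -> S) (p : T) :
  f =1 g -> {for p, continuous f} -> {for p, continuous g}.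
Proof. by move/funext ->. Qed.

Lemma continuous_prod_coords (T : topologicalType) (f : T -> 'rV[R]_(dim PM)) (p : T) :
  {for p, continuous (fun q => f q *m base_mx)} ->
  (forall j, {for p, continuous (fun q => f q *m fiber_mx j)}) ->
  {for p, continuous f}.
Proof.
move=> fB fF; apply: continuous_mxP => i s; rewrite (ord1 i).
case: (prod_entry s) => [[t E]|[j [t E]]]; apply: continuous_at_ext (fsym (fun _ => E _)) _.
  exact: (@continuous_comp _ _ _ _ (fun N : 'rV_(dim B) => N 0 t) p fB
    (@coord_continuous _ _ _ 0 t _)).
exact: (@continuous_comp _ _ _ _ (fun N : 'rV_(dim (F j)) => N 0 t) p (fF j)
  (@coord_continuous _ _ _ 0 t _)).
Qed.

Lemma prod_codomainE (c : chart PM) : codomain c =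
  [set x | codomain c.1 (x *m base_mx) /\ forall j, codomain (c.2 j) (x *m fiber_mx j)].
Proof.
by apply/seteqP; split=> x /(prod_coords_image c (domain c.1) (fun j => domain (c.2 j))).
Qed.

Lemma prod_overlapE (c d : chart PM) : overlap c d =
  [set x | overlap c.1 d.1 (x *m base_mx) /\
           forall j, overlap (c.2 j) (d.2 j) (x *m fiber_mx j)].
Proof.
rewrite /overlap.
have -> : domain c `&` domain d =
    [set p : PM | (domain c.1 `&` domain d.1) p.1 /\
                  forall j, (domain (c.2 j) `&` domain (d.2 j)) (p.2 j)].
  apply/seteqP; split=> p [].
    by move=> [cB cF] [dB dF]; split=> // j; split.
  by move=> [cB dB] cdF; split; split=> // j; case: (cdF j).
by apply/seteqP; split=> x /(prod_coords_image c (domain c.1 `&` domain d.1)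
  (fun j => domain (c.2 j) `&` domain (d.2 j))).
Qed.

Lemma is_chart_prod (c : chart PM) :
  is_chart c.1 -> (forall j, is_chart (c.2 j)) -> is_chart c.
Proof.
move=> hB hF; have [oB ocB pB cB kB] := hB; split.
- have oF : open [set q : prod_topology (fun j => points (F j)) |
      forall j, domain (c.2 j) (q j)].
    have oFj j : open (domain (c.2 j)) by case: (hF j).
    exact: (@open_cylinder _ (fun j => points (F j)) (fun j => domain (c.2 j)) oFj).
  rewrite openE => p [/= Bp Fp].
  exists (domain c.1, [set q | forall j, domain (c.2 j) (q j)]) => //=.
  split; first exact: open_nbhs_nbhs.
  exact: (open_nbhs_nbhs (conj oF Fp)).
- have oFj j : open (codomain (c.2 j)) by case: (hF j).
  rewrite prod_codomainE.
  exact: (@open_prod_coords (codomain c.1) (fun j => codomain (c.2 j)) ocB oFj).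
- move=> p [/= Bp Fp]; rewrite row_mxKl pB//; case: p Bp Fp => b q /= _ Fq.
  congr pair; apply: functional_extensionality_dep => j.
  by rewrite row_mxKr mxrowK; case: (hF j) => _ _ + _ _; apply.
- move=> p [/= Bp Fp]; apply: continuous_prod_coords => [|j].
    apply: continuous_at_ext (fsym (prod_coords_base c)) _.
    exact: (@continuous_comp _ _ _ fst (coords c.1) p cvg_fst (cB _ Bp)).
  apply: continuous_at_ext (fsym (prod_coords_fiber c ^~ j)) _.
  have [_ _ _ cF _] := hF j.
  apply: (@continuous_comp _ _ _ (fun p : PM => p.2 j) (coords (c.2 j)) p _ (cF _ (Fp j))).
  exact: (@continuous_comp (prod_points B F) (prod_topology (fun j => points (F j))) (F j)
    snd (fun q => q j) p cvg_snd (@continuous_proj _ (fun j => points (F j)) j p.2)).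
- rewrite prod_codomainE => x [Bx Fx].
  have H1 : {for x, continuous (fun x : 'rV[R]_(dim PM) => param c.1 (x *m base_mx))}.
    exact: (@continuous_comp _ _ _ _ (param c.1) x (@continuous_mulmxr _ _ base_mx x)
      (kB _ Bx)).
  have H2 : {for x, continuous (fun x : 'rV[R]_(dim PM) =>
      (fun j => param (c.2 j) (x *m fiber_mx j)) : prod_topology (fun j => points (F j)))}.
    apply: continuous_prod => j; have [_ _ _ _ kF] := hF j.
    exact: (@continuous_comp _ _ _ _ (param (c.2 j)) x
      (@continuous_mulmxr _ _ (fiber_mx j) x) (kF _ (Fx j))).
  have E : param c = (fun x : 'rV[R]_(dim PM) => (param c.1 (x *m base_mx),
      (fun j => param (c.2 j) (x *m fiber_mx j)) : prod_topology (fun j => points (F j)))).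
    apply/funext => y /=; rewrite -mul_base_mx; congr pair.
    by apply: functional_extensionality_dep => j; rewrite -mul_fiber_mx.
  rewrite E; exact: cvg_pair H1 H2.
Qed.

Lemma is_manifold_prod :
  is_manifold B -> (forall j, is_manifold (F j)) -> is_manifold PM.
Proof.
move=> hB hF; split.
- apply: hausdorff_pair; first by case: hB.
  by apply: (@hausdorff_product _ (fun j => points (F j))) => j; case: (hF j).
- apply: second_countable_pair; first by case: hB.
  by apply: second_countable_prod_topology => j; case: (hF j).
- move=> c; apply: is_chart_prod => [|j]; first by case: hB.
  by case: (hF j).
- by move=> p; split=> [|j]; exact: chart_at_domain.
(* Each block of a transition map of the product is a transition map of a factor precomposed with a
   linear projection. *)
- move=> c d k; rewrite -/(overlap c d).
  have oU : open (overlap c d).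
    rewrite prod_overlapE.
    exact: (@open_prod_coords (overlap c.1 d.1) (fun j => overlap (c.2 j) (d.2 j))
      (@open_overlap _ _ hB c.1 d.1) (fun j => @open_overlap _ _ (hF j) (c.2 j) (d.2 j))).
  have lin n m (A : 'M[R]_(n, m)) (U : set 'rV_n) :
      open U -> of_class k U (fun x : 'rV_n => x *m A).
    by move=> oU'; exact: (of_class_mulmx oU' (@of_class_id _ _ k U) (of_class_cst k U A)).
  apply: of_class_prod => // [|j].
    have H := of_class_comp oU (@open_overlap _ _ hB c.1 d.1)
      (fun x => @proj_overlap _ _ _ _ _ _ base_projection c d x)
      (lin _ _ base_mx _ oU) (transition_smooth hB c.1 d.1 k).
    apply: of_class_eq H => // x _.
    by rewrite (proj_transition base_projection).
  have H := of_class_comp oU (@open_overlap _ _ (hF j) (c.2 j) (d.2 j))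
    (fun x => @proj_overlap _ _ _ _ _ _ (fiber_projection j) c d x)
    (lin _ _ (fiber_mx j) _ oU) (transition_smooth (hF j) (c.2 j) (d.2 j) k).
  apply: of_class_eq H => // x _.
  by rewrite (proj_transition (fiber_projection j)).
Qed.

End ProductManifold.

(** * Pointwise algebra of tensors and inner products *)

Section TensorCoordinates.
Context {R : realType} (M : atlas_space R).
Implicit Types (g : tensor2 M) (c : chart M) (p : M).

Lemma tensor2_coordsD g1 g2 c x :
  tensor2_coords (fun p => g1 p + g2 p) c x =
  tensor2_coords g1 c x + tensor2_coords g2 c x.
Proof.
have alg (J A1 A2 : 'M[R]_(dim M)) :
    J *m (A1 + A2) *m J^T = J *m A1 *m J^T + J *m A2 *m J^T.
  by rewrite mulmxDr mulmxDl.
exact: alg.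
Qed.

Lemma tensor2_coords_sum (I : finType) (g : I -> tensor2 M) c x :
  tensor2_coords (fun p => \sum_i g i p) c x = \sum_i tensor2_coords (g i) c x.
Proof.
have alg (J : 'M[R]_(dim M)) (A : I -> 'M[R]_(dim M)) :
    J *m (\sum_i A i) *m J^T = \sum_i J *m A i *m J^T.
  by rewrite mulmx_sumr mulmx_suml.
exact: alg.
Qed.

Lemma tensor2_coordsZ (a : M -> R) g c x :
  tensor2_coords (fun p => a p *: g p) c x =
  a (param c x) *: tensor2_coords g c x.
Proof.
have alg (J A : 'M[R]_(dim M)) (b : R) :
    J *m (b *: A) *m J^T = b *: (J *m A *m J^T).
  by rewrite -scalemxAr -scalemxAl.
exact: alg.
Qed.

Lemma innerDl g p (u v w : tangent p) :
  inner g (u + v : tangent p) w = inner g u w + inner g v w.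
Proof. by rewrite /inner !mulmxDl mxE. Qed.

Lemma innerZl g p (a : R) (u v : tangent p) :
  inner g (a *: u : tangent p) v = a * inner g u v.
Proof. by rewrite /inner -!scalemxAl mxE. Qed.

Lemma innerNl g p (u v : tangent p) :
  inner g (- u : tangent p) v = - inner g u v.
Proof. by rewrite /inner !mulNmx mxE. Qed.

Lemma inner_suml (I : finType) g p (u : I -> tangent p) (v : tangent p) :
  inner g (\sum_i u i : tangent p) v = \sum_i inner g (u i) v.
Proof. by rewrite /inner !mulmx_suml summxE. Qed.

(** Provides the linear structure under which [inner g u] can be the value of a [one_form]. *)
Lemma inner_is_linear g p (u : tangent p) : linear (inner g u).
Proof. by move=> a v w; rewrite /inner linearP/= mulmxDr -scalemxAr !mxE. Qed.

HB.instance Definition _ g p (u : tangent p) :=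
  GRing.isLinear.Build R (tangent p) R *:%R (inner g u) (inner_is_linear g u).

End TensorCoordinates.

(** * Slices of the product through a point *)

Section Slices.
Context {R : realType} {l : nat} (B : atlas_space R) (F : 'I_l -> atlas_space R).
Context (hB : is_manifold B) (hF : forall j, is_manifold (F j)).
Notation PM := (prod_manifold B F).
Variable p : PM.

Let fiber_coords : forall j, 'rV[R]_(dim (F j)) :=
  fun j => coords (chart_at (p.2 j)) (p.2 j).

Lemma base_slice : chart_slice (@proj_base R l B F) (fun c : chart PM => c.1)
  (fun q : B => (q, p.2) : PM)
  (fun c : chart B => (c, fun j => chart_at (p.2 j)) : chart PM)
  (fun y => row_mx y (\mxrow_j fiber_coords j)).
Proof.
split=> //=.
  by move=> c q cq; split=> // j; exact: chart_at_domain.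
move=> k; apply: of_class_prod => [| |j]; first exact: openT.
  apply: of_class_eq (@of_class_id _ _ k setT); first exact: openT.
  by move=> y _; rewrite mul_base_mx row_mxKl.
apply: of_class_eq (of_class_cst k setT (fiber_coords j)); first exact: openT.
by move=> y _; rewrite mul_fiber_mx row_mxKr mxrowK.
Qed.

(** Away from [j] the point, its chart and its coordinates are frozen at those of [p]; choosing
    [chart_at (p.2 i)] there keeps the slice inside the product domain. *)
Lemma fiber_slice (j : 'I_l) :
  chart_slice (@proj_fiber R l B F j) (fun c : chart PM => c.2 j)
  (fun q : F j => (p.1, @dfwith _ (fun i => points (F i)) p.2 j q) : PM)
  (fun c : chart (F j) => (chart_at p.1,
     @dfwith _ (fun i => chart (F i)) (fun i => chart_at (p.2 i)) j c) : chart PM)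
  (fun y => row_mx (coords (chart_at p.1) p.1)
     (\mxrow_i @dfwith _ (fun i => 'rV[R]_(dim (F i))) fiber_coords j y i)).
Proof.
split=> /=.
- by move=> q; rewrite /proj_fiber /= dfwithin.
- by move=> c; rewrite dfwithin.
- move=> c q cq; split=> [|i]; first exact: chart_at_domain.
  have [<-|ji] := eqVneq j i; first by rewrite !dfwithin.
  by rewrite !dfwithout//; exact: chart_at_domain.
- move=> c q; congr row_mx; apply: eq_mxrow => i.
  have [<-|ji] := eqVneq j i; first by rewrite !dfwithin.
  by rewrite !dfwithout.
move=> k; apply: of_class_prod => [| |i]; first exact: openT.
  apply: of_class_eq (of_class_cst k setT (coords (chart_at p.1) p.1)).
    exact: openT.
  by move=> y _; rewrite mul_base_mx row_mxKl.
have [ji|ji] := eqVneq j i.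
  subst i; apply: of_class_eq (@of_class_id _ _ k setT); first exact: openT.
  by move=> y _; rewrite mul_fiber_mx row_mxKr mxrowK dfwithin.
apply: of_class_eq (of_class_cst k setT (fiber_coords i)); first exact: openT.
by move=> y _; rewrite mul_fiber_mx row_mxKr mxrowK dfwithout.
Qed.

End Slices.

(** * The warped metric *)

Section MatrixBilinear.
Context {R : realType}.

Lemma derive_comp_mulmxr n m (W : normedModType R) (A : 'M[R]_(n, m))
    (f : 'rV[R]_m -> W) x v :
  differentiable f (x *m A) ->
  'D_v (fun y => f (y *m A)) x = 'D_(v *m A) f (x *m A).
Proof.
move=> df; have E := derive_comp_along v (differentiable_mulmxr A x) df.
rewrite jacobian_mulmxr in E; exact: E.
Qed.

Lemma bilinear_proj n m (A : 'M[R]_(n, m)) (G : 'M[R]_m) (u v : 'rV[R]_n) :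
  (u *m (A *m G *m A^T) *m v^T) 0 0 = ((u *m A) *m G *m (v *m A)^T) 0 0.
Proof. by rewrite trmx_mul !mulmxA. Qed.

Lemma bilinearD n (G H : 'M[R]_n) (u v : 'rV[R]_n) :
  (u *m (G + H) *m v^T) 0 0 = (u *m G *m v^T) 0 0 + (u *m H *m v^T) 0 0.
Proof. by rewrite mulmxDr mulmxDl [LHS]mxE. Qed.

Lemma bilinearZ n (a : R) (G : 'M[R]_n) (u v : 'rV[R]_n) :
  (u *m (a *: G) *m v^T) 0 0 = a * (u *m G *m v^T) 0 0.
Proof. by rewrite -scalemxAr -scalemxAl [LHS]mxE. Qed.

Lemma bilinear_sum n (I : finType) (G : I -> 'M[R]_n) (u v : 'rV[R]_n) :
  (u *m (\sum_i G i) *m v^T) 0 0 = \sum_i (u *m G i *m v^T) 0 0.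
Proof. by rewrite mulmx_sumr mulmx_suml summxE. Qed.

End MatrixBilinear.

Section WarpedMetric.
Context {R : realType} {l : nat} (B : atlas_space R) (F : 'I_l -> atlas_space R).
Context (gB : tensor2 B) (gF : forall j, tensor2 (F j)) (f : 'I_l -> B -> R).
Arguments gF : clear implicits.
Context (ssB : singular_semi_riemannian gB)
  (ssF : forall j, singular_semi_riemannian (gF j))
  (f_smooth : forall j, smooth_fun (f j)).
Notation PM := (prod_manifold B F).
Notation g := (warped_metric gB gF f).
Notation PB := (base_mx B F).
Notation PF := (fiber_mx B F).

Let hB : is_manifold B. Proof. by case: ssB. Qed.
Let hF j : is_manifold (F j). Proof. by case: (ssF j). Qed.
Let hM : is_manifold PM. Proof. exact: is_manifold_prod. Qed.
Let sB : smooth_tensor2 gB. Proof. by case: ssB. Qed.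
Let sF j : smooth_tensor2 (gF j). Proof. by case: (ssF j). Qed.

Lemma warped_metricE (p : PM) :
  g p = PB *m gB p.1 *m PB^T + \sum_j f j p.1 ^+ 2 *: (PF j *m gF j (p.2 j) *m (PF j)^T).
Proof.
have tB := tangent_map_proj hM (base_projection B F) p.
have tF j := tangent_map_proj hM (fiber_projection B F j) p.
rewrite /warped_metric /pullback tB.
by under eq_bigr do rewrite tF.
Qed.

Lemma warped_metric_sym (p : PM) : (g p)^T = g p.
Proof.
have congr_sym n m (A : 'M[R]_(n, m)) (G : 'M[R]_m) :
    G^T = G -> (A *m G *m A^T)^T = A *m G *m A^T.
  by move=> GE; rewrite !trmx_mul trmxK GE mulmxA.
rewrite warped_metricE linearD linear_sum/= congr_sym; last by case: ssB.
congr (_ + _); apply: eq_bigr => j _.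
by rewrite linearZ/= congr_sym//; case: (ssF j).
Qed.

Lemma warped_coords (c : chart PM) x : codomain c x ->
  tensor2_coords g c x = PB *m tensor2_coords gB c.1 (x *m PB) *m PB^T
    + \sum_j f j (param c.1 (x *m PB)) ^+ 2 *:
        (PF j *m tensor2_coords (gF j) (c.2 j) (x *m PF j) *m (PF j)^T).
Proof.
move=> cx.
refine (etrans (tensor2_coordsD _ _ c x) _).
refine (etrans (congr1 (fun N => N + _)
  (pullback_coords hM hB (base_projection B F) gB cx)) _).
refine (congr1 (fun N => _ + N) _).
refine (etrans (tensor2_coords_sum _ c x) _).
apply: eq_bigr => j _.
refine (etrans (tensor2_coordsZ (fun p : PM => f j p.1 ^+ 2) _ c x) _).
rewrite (pullback_coords hM (hF j) (fiber_projection B F j) (gF j) cx).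
have -> : (param c x).1 = param c.1 (x *m PB) by rewrite mul_base_mx.
by [].
Qed.

Lemma of_class_comp_mulmxr n m p q k (U : set 'rV[R]_n) (V : set 'rV[R]_m)
    (A : 'M[R]_(n, m)) (h : 'rV[R]_m -> 'M[R]_(p, q)) :
  open U -> open V -> (forall x, U x -> V (x *m A)) -> of_class k V h ->
  of_class k U (fun x => h (x *m A)).
Proof.
move=> oU oV UV Ch; apply: (of_class_comp oU oV UV _ Ch).
exact: (of_class_mulmx oU (@of_class_id _ _ k U) (of_class_cst k U A)).
Qed.

Lemma smooth_warped_metric : smooth_tensor2 g.
Proof.
move=> c k; have oC := @open_codomain _ _ hM c.
have pB x := @proj_codomain _ _ _ _ _ _ (base_projection B F) c x.
have pF j x := @proj_codomain _ _ _ _ _ _ (fiber_projection B F j) c x.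
have CB := of_class_comp_mulmxr oC (@open_codomain _ _ hB c.1) pB (sB c.1 k).
have CF j := of_class_comp_mulmxr oC (@open_codomain _ _ (hF j) (c.2 j)) (pF j)
  (sF (c.2 j) k).
have Cf j : of_class k (codomain c) (fun x => f j (param c.1 (x *m PB))).
  apply: (of_class_comp_real oC pB _ (f_smooth j c.1 k)).
  exact: (of_class_mulmx oC (@of_class_id _ _ k _) (of_class_cst k _ PB)).
have cmx n m (A : 'M[R]_(n, m)) : of_class k (codomain c) (cst A : 'rV_(dim PM) -> _).
  exact: of_class_cst.
have H1 := of_class_mulmx oC (of_class_mulmx oC (cmx _ _ PB) CB) (cmx _ _ PB^T).
have H2 : of_class k (codomain c) (fun x => \sum_j f j (param c.1 (x *m PB)) ^+ 2 *:
    (PF j *m tensor2_coords (gF j) (c.2 j) (x *m PF j) *m (PF j)^T)).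
  apply: of_class_sum => // j _.
  exact: (of_classZ oC (of_classM oC (Cf j) (Cf j))
    (of_class_mulmx oC (of_class_mulmx oC (cmx _ _ (PF j)) (CF j)) (cmx _ _ (PF j)^T))).
by apply: of_class_eq (of_classD oC H1 H2) => // x /[!inE] cx; rewrite warped_coords.
Qed.

Lemma inner_warped (p : PM) (u v : 'rV[R]_(dim PM)) :
  inner g (p := p) u v =
  inner gB (p := p.1) (u *m PB) (v *m PB) +
  \sum_j f j p.1 ^+ 2 * inner (gF j) (p := p.2 j) (u *m PF j) (v *m PF j).
Proof.
rewrite /inner warped_metricE bilinearD bilinear_proj bilinear_sum.
by under eq_bigr do rewrite bilinearZ bilinear_proj.
Qed.

(** In a product chart each Gram matrix depends only on the coordinates of its own factor and each
    weight only on those of the base, so [v] is projected before each derivative is taken. *)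
Lemma deriv_warped (p : PM) (v : 'rV[R]_(dim PM)) :
  deriv_tensor2 g p v = PB *m deriv_tensor2 gB p.1 (v *m PB) *m PB^T
    + \sum_j ((2 * f j p.1 * differential (f j) p.1 (v *m PB)) *:
                (PF j *m gF j (p.2 j) *m (PF j)^T)
              + f j p.1 ^+ 2 *:
                (PF j *m deriv_tensor2 (gF j) (p.2 j) (v *m PF j) *m (PF j)^T)).
Proof.
set c := chart_at p; set x := base_coords p.
have oC := @open_codomain _ _ hM c.
have cx : codomain c x by exact: base_coords_codomain.
have xB : x *m PB = base_coords p.1 by exact: (proj_base_coords (base_projection B F)).
have xF j : x *m PF j = base_coords (p.2 j).
  exact: (proj_base_coords (fiber_projection B F j)).
have bB := base_coords_codomain hB p.1.
have bF j := base_coords_codomain (hF j) (p.2 j).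
pose HB y := PB *m tensor2_coords gB c.1 (y *m PB) *m PB^T.
pose a j y := f j (param c.1 (y *m PB)).
pose HF j y := PF j *m tensor2_coords (gF j) (c.2 j) (y *m PF j) *m (PF j)^T.
have dBx : differentiable (tensor2_coords gB c.1) (x *m PB).
  by rewrite xB; exact: (sB c.1 1%N).1.
have dFx j : differentiable (tensor2_coords (gF j) (c.2 j)) (x *m PF j).
  by rewrite xF; exact: (sF (c.2 j) 1%N).1.
have dfx j : differentiable (f j \o param c.1) (x *m PB).
  by rewrite xB; exact: (f_smooth j c.1 1%N).1.
have derB : derivable (fun y => tensor2_coords gB c.1 (y *m PB)) x v.
  exact: (diff_derivable (differentiable_comp (differentiable_mulmxr PB x) dBx)).
have derF j : derivable (fun y => tensor2_coords (gF j) (c.2 j) (y *m PF j)) x v.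
  exact: (diff_derivable (differentiable_comp (differentiable_mulmxr (PF j) x) (dFx j))).
have derf j : derivable (a j) x v.
  exact: (diff_derivable (differentiable_comp (differentiable_mulmxr PB x) (dfx j))).
have derHB : derivable HB x v.
  exact: (derivable_mulmx (derivable_mulmx (derivable_cst _ _ _) derB) (derivable_cst _ _ _)).
have derHF j : derivable (HF j) x v.
  exact: (derivable_mulmx (derivable_mulmx (derivable_cst _ _ _) (derF j))
    (derivable_cst _ _ _)).
have dera2 j : derivable (fun y => a j y * a j y) x v by exact: (derivableM (derf j) (derf j)).
have derS j := derivableZl (dera2 j) (derHF j).
have EB : 'D_v HB x = PB *m deriv_tensor2 gB p.1 (v *m PB) *m PB^T.
  refine (etrans (derive_mulmxr _ (derivable_mulmx (derivable_cst _ _ _) derB)) _).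
  refine (congr1 (fun N => N *m PB^T) (etrans (derive_mulmxl _ derB) _)).
  refine (congr1 (mulmx PB) (etrans (derive_comp_mulmxr _ dBx) _)).
  by rewrite xB.
have EF j : 'D_v (HF j) x =
    PF j *m deriv_tensor2 (gF j) (p.2 j) (v *m PF j) *m (PF j)^T.
  refine (etrans (derive_mulmxr _ (derivable_mulmx (derivable_cst _ _ _) (derF j))) _).
  refine (congr1 (fun N => N *m (PF j)^T) (etrans (derive_mulmxl _ (derF j)) _)).
  refine (congr1 (mulmx (PF j)) (etrans (derive_comp_mulmxr _ (dFx j)) _)).
  by rewrite xF.
have aE j : a j x = f j p.1.
  by rewrite /a xB; exact: (congr1 (f j) (param_base_coords hB p.1)).
have Ea j : 'D_v (a j) x = differential (f j) p.1 (v *m PB).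
  refine (etrans (derive_comp_mulmxr _ (dfx j)) _).
  refine (etrans (deriveE _ (dfx j)) _).
  by rewrite xB.
have HFx j : HF j x = PF j *m gF j (p.2 j) *m (PF j)^T.
  by rewrite /HF xF; exact: (congr1 (fun N => _ *m N *m _) (tensor2_coords_base (hF j) _ _)).
have Ea2 j : 'D_v (fun y => a j y * a j y) x =
    2 * f j p.1 * differential (f j) p.1 (v *m PB).
  refine (etrans (deriveM (derf j) (derf j)) _).
  rewrite aE Ea; move: (f j p.1) (differential _ _ _) => r s.
  by rewrite -[r *: s]/(r * s); ring.
refine (etrans (derive_eq_open v (g := fun y => HB y +
  (\sum_j (fun y => (a j y * a j y) *: HF j y)) y) oC cx _) _).
  move=> y cy; rewrite warped_coords// fct_sumE; congr (_ + _).
refine (etrans (deriveD derHB (derivable_sum derS)) _).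
rewrite EB; refine (congr1 (fun N => _ + N) _).
refine (etrans (derive_sum derS) _); apply: eq_bigr => j _.
refine (etrans (deriveZl (dera2 j) (derHF j)) _).
by rewrite Ea2 EF aE HFx expr2.
Qed.

(** The cross terms come from the derivative 2 f_j df_j of the weight f_j^2, whose factor 2 is
    absorbed by the 1/2 in [christoffel]. *)
Lemma christoffel_warped (p : PM) (u v w : 'rV[R]_(dim PM)) :
  christoffel g p u v w =
  christoffel gB p.1 (u *m PB) (v *m PB) (w *m PB) +
  \sum_j (f j p.1 ^+ 2 *
            christoffel (gF j) (p.2 j) (u *m PF j) (v *m PF j) (w *m PF j)
     + f j p.1 *
       (differential (f j) p.1 (u *m PB) *
          inner (gF j) (p := p.2 j) (v *m PF j) (w *m PF j)
        + differential (f j) p.1 (v *m PB) *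
          inner (gF j) (p := p.2 j) (w *m PF j) (u *m PF j)
        - differential (f j) p.1 (w *m PB) *
          inner (gF j) (p := p.2 j) (u *m PF j) (v *m PF j))).
Proof.
have dE (a b d : 'rV[R]_(dim PM)) : (a *m deriv_tensor2 g p d *m b^T) 0 0 =
    ((a *m PB) *m deriv_tensor2 gB p.1 (d *m PB) *m (b *m PB)^T) 0 0 +
    \sum_j (2 * f j p.1 * differential (f j) p.1 (d *m PB) *
        inner (gF j) (p := p.2 j) (a *m PF j) (b *m PF j)
      + f j p.1 ^+ 2 *
        ((a *m PF j) *m deriv_tensor2 (gF j) (p.2 j) (d *m PF j) *m (b *m PF j)^T) 0 0).
  rewrite deriv_warped bilinearD bilinear_proj bilinear_sum.
  refine (congr1 (fun r => _ + r) _); apply: eq_bigr => j _.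
  by rewrite bilinearD !bilinearZ !bilinear_proj.
rewrite /christoffel !dE.
(* Gathers the three sums into one, so that the identity can be checked for each [j] separately. *)
have split_sum (x y z : R) (a b d : 'I_l -> R) :
    2^-1 * (x + \sum_j a j + (y + \sum_j b j) - (z + \sum_j d j)) =
    2^-1 * (x + y - z) + \sum_j 2^-1 * (a j + b j - d j).
  rewrite -mulr_sumr sumrB big_split/=; ring.
rewrite split_sum; refine (congr1 (fun r => _ + r) _); apply: eq_bigr => j _.
move: (differential _ _ _) (differential _ _ _) (differential _ _ _)
  (inner _ _ _) (inner _ _ _) (inner _ _ _) (_ 0 0) (_ 0 0) (_ 0 0) (f j p.1).
by move=> *; field.
Qed.

End WarpedMetric.

(** * Representing the Koszul form of the warped metric at a point *)

Lemma koszul_warped_dual (R : realType) (l : nat)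
    (B : atlas_space R) (gB : tensor2 B)
    (F : 'I_l -> atlas_space R) (gF : forall j : 'I_l, tensor2 (F j))
    (f : 'I_l -> B -> R)
    (hB : radical_stationary gB)
    (hF : forall j : 'I_l, radical_stationary (gF j))
    (f_smooth : forall j : 'I_l, smooth_fun (f j))
    (df_A : forall j : 'I_l, A_bullet gB (differential (f j)))
    (X Y : vector_field (prod_manifold B F)) (p : prod_manifold B F) :
  smooth_vf X -> smooth_vf Y ->
  exists u : tangent p, forall Z : vector_field (prod_manifold B F), smooth_vf Z ->
    koszul (warped_metric gB gF f) X Y Z p = inner (warped_metric gB gF f) u (Z p).
Proof.
move=> sX sY; have [ssB _] := hB; have ssF j := (hF j).1.
have mB : is_manifold B by case: ssB.
have mF j : is_manifold (F j) by case: (ssF j).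
have mM : is_manifold (prod_manifold B F) by exact: is_manifold_prod.
pose PB := base_mx B F; pose PF := fiber_mx B F.
have ipB : (proj_base p, p.2) = p by case: p.
have ipF j : (p.1, @dfwith _ (fun i => points (F i)) p.2 j (proj_fiber j p)) = p.
  rewrite [RHS]surjective_pairing; congr pair.
  apply: functional_extensionality_dep => i /=.
  by have [<-|ji] := eqVneq j i; rewrite ?dfwithin ?dfwithout.
have [uB uBE] := christoffel_dual mM (base_projection B F) (base_slice mF p)
  ipB hB sX sY.
have exF j := christoffel_dual mM (fiber_projection B F j) (fiber_slice mB mF p j)
  (ipF j) (hF j) sX sY.
pose uF j : 'rV[R]_(dim (F j)) := sval (cid (exF j)).
have uFE j := svalP (cid (exF j)).
have exG j := (df_A j).2 p.1.
pose grad j : 'rV[R]_(dim B) := sval (cid (exG j)).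
have gradE j v : differential (f j) p.1 v = inner gB (p := p.1) (grad j) v :=
  svalP (cid (exG j)) v.
pose x : 'rV[R]_(dim (prod_manifold B F)) := X p.
pose y : 'rV[R]_(dim (prod_manifold B F)) := Y p.
pose df j (v : 'rV[R]_(dim (prod_manifold B F))) : R :=
  differential (f j) p.1 (v *m PB).
pose xy j : R := inner (gF j) (p := p.2 j) (x *m PF j) (y *m PF j).
pose aB : 'rV[R]_(dim B) := uB - \sum_j (f j p.1 * xy j) *: grad j.
(* Where [f j] vanishes so does the term divided by [f j] below, and Rocq's
   convention [0^-1 = 0] makes the formula valid there too. *)
pose aF j : 'rV[R]_(dim (F j)) :=
  uF j + (f j p.1)^-1 *: (df j x *: (y *m PF j) + df j y *: (x *m PF j)).
pose a : 'rV[R]_(dim (prod_manifold B F)) := row_mx aB (\mxrow_j aF j).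
have aBE : a *m PB = aB by rewrite mul_base_mx row_mxKl.
have aFE j : a *m PF j = aF j by rewrite mul_fiber_mx row_mxKr mxrowK.
(* The two summands answer the two terms of [koszulE]: [deriv_vf Y p x] represents the first, [a]
   the Christoffel term. *)
exists (deriv_vf Y p x + a) => Z sZ.
rewrite (koszulE mM p (warped_metric_sym f ssB ssF) (smooth_warped_metric ssB ssF f_smooth)
  sX sY sZ) innerDl.
apply: (congr1 (fun r => _ + r)).
rewrite (christoffel_warped ssB ssF f_smooth) (inner_warped f ssB ssF) aBE.
set z : 'rV[R]_(dim (prod_manifold B F)) := Z p.
have -> : christoffel gB p.1 (x *m PB) (y *m PB) (z *m PB) =
  inner gB (p := p.1) uB (z *m PB) by exact: (uBE Z sZ).
have -> : inner gB (p := p.1) aB (z *m PB) =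
    inner gB (p := p.1) uB (z *m PB) - \sum_j f j p.1 * xy j * df j z.
  rewrite innerDl innerNl inner_suml; congr (_ - _); apply: eq_bigr => j _.
  by rewrite innerZl -gradE.
(* The terms in [uB] cancel; the correction sum coming from [aB] is merged with the sum over the
   fibers, and the two sides are compared for each [j]. *)
rewrite -addrA; congr (_ + _); rewrite addrC -sumrB; apply: eq_bigr => j _.
have -> : christoffel (gF j) (p.2 j) (x *m PF j) (y *m PF j) (z *m PF j) =
  inner (gF j) (p := p.2 j) (uF j) (z *m PF j) by exact: (uFE j Z sZ).
rewrite aFE innerDl innerZl innerDl !innerZl.
rewrite (inner_sym (z *m PF j : tangent (p.2 j)) (x *m PF j)); last by case: (ssF j).
rewrite -/(df j x) -/(df j y) -/(df j z) -/(xy j).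
move: (inner _ _ _) (inner _ _ _) (inner _ _ _) (df j x) (df j y) (df j z) (xy j).
have [-> *|fj0 *] := eqVneq (f j p.1) 0; first by rewrite invr0; ring.
by field.
Qed.

Theorem theorem5p3 (R : realType) (l : nat)
    (B : atlas_space R) (gB : tensor2 B)
    (F : 'I_l -> atlas_space R) (gF : forall j : 'I_l, tensor2 (F j))
    (f : 'I_l -> B -> R)
    (hB : radical_stationary gB)
    (hF : forall j : 'I_l, radical_stationary (gF j))
    (f_smooth : forall j : 'I_l, smooth_fun (f j))
    (df_A : forall j : 'I_l, A_bullet gB (differential (f j))) :
  radical_stationary (warped_metric gB gF f).
Proof.
have [ssB _] := hB; have ssF j := (hF j).1.
have mM : is_manifold (prod_manifold B F).
  by apply: is_manifold_prod => [|j]; [case: ssB | case: (ssF j)].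
have sg := smooth_warped_metric ssB ssF f_smooth.
split; first by split=> //; exact: warped_metric_sym f ssB ssF.
move=> X Y sX sY.
(* One representing vector is chosen at each point; when the metric is degenerate it is not unique,
   so no smoothness in [p] can be expected of it. *)
pose u p : tangent p := sval (cid (koszul_warped_dual hB hF f_smooth df_A p sX sY)).
have uE p := svalP (cid (koszul_warped_dual hB hF f_smooth df_A p sX sY)).
exists (fun p => inner (warped_metric gB gF f) (u p) : {linear tangent p -> R}).
  split=> [Z sZ|p]; last by exists (u p).
  (* Although [u] may be irregular, on a smooth [Z] the form takes the values of K(X, Y, Z), whose
     smoothness is known independently of [u]. *)
  rewrite (_ : (fun p => _) = koszul (warped_metric gB gF f) X Y Z).
    exact: smooth_koszul.
  by apply/funext => p; rewrite (uE p Z sZ).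
by move=> Z sZ p; exact: uE.
Qed.
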